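(* Assume that $H$ is coercive, i.e. $\lim_{|p|\to\infty}\min_{x\in\mathbb T^n}H_i(x,p)=\infty$ for every $i\in\mathbb I$, and that $B(x)$ is a monotone matrix for every $x\in\mathbb T^n$. Let $\lambda>0$ and $(z,k)\in\mathbb T^n\times\mathbb I$. Let $v^\lambda\in C(\mathbb T^n)^m$ be the unique solution of $\lambda v^\lambda+Bv^\lambda+H[v^\lambda]=0$ in $\mathbb T^n$. Then there exists $\nu^{z,k,\lambda}=(\nu^{z,k,\lambda}_i)_{i\in\mathbb I}\in\mathcal G'(z,k,\lambda)$ such that $$v^\lambda_k(z)=\langle\nu^{z,k,\lambda},L\rangle.$$
   Context: Let $m,n\in\mathbb N$, $\mathbb I=\{1,\dots,m\}$, let $\mathbb T^n$ be the $n$-dimensional flat torus, $\Xi$ a (nonempty) compact metric space, $g=(g_i)_{i\in\mathbb I}\in C(\mathbb T^n\times\Xi,\mathbb R^n)^m$ and $L=(L_i)_{i\in\mathbb I}\in C(\mathbb T^n\times\Xi)^m$. For $\phi=(\phi_i)_{i\in\mathbb I}\in C(\mathbb T^n\times\Xi)^m$ set $H_\phi=(H_{\phi,i})_{i\in\mathbb I}$, $H_{\phi,i}(x,p)=\max_{\xi\in\Xi}[-g_i(x,\xi)\cdot p-\phi_i(x,\xi)]$ for $(x,p)\in\mathbb T^n\times\mathbb R^n$, and $H=H_L$. Let $B=(b_{ij})_{i,j\in\mathbb I}\in C(\mathbb T^n)^{m\times m}$, acting by $(Bu)_i(x)=\sum_{j\in\mathbb I}b_{ij}(x)u_j(x)$,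 and $B^\lambda=\lambda I+B$ for $\lambda\ge0$. $F[u]$ stands for $(F_i(x,Du_i(x)))_{i\in\mathbb I}$. $\mathbf 1=(1,\dots,1)\in\mathbb R^m$, so $(B^\lambda\mathbf 1)_i(x)=\lambda+\sum_{j\in\mathbb I}b_{ij}(x)$. Monotone matrix: a real $m\times m$ matrix $A$ is monotone if whenever $u\in\mathbb R^m$ and $u_k=\max_{i\in\mathbb I}u_i\ge0$, then $(Au)_k\ge0$. Viscosity sense: $u\in C(\mathbb T^n)^m$ is a subsolution (resp. supersolution) of $B^\lambda u+F[u]=0$ in $\mathbb T^n$ if for every $i\in\mathbb I$, $\psi\in C^1(\mathbb T^n)$ and every maximum (resp. minimum) point $x$ of $u_i-\psi$, one has $(B^\lambda u)_i(x)+F_i(x,D\psi(x))\le0$ (resp. $\ge0$); a solution is both. It is known that under coercivity of $H$ and monotonicity of $B$, for each $\lambda>0$ the system $B^\lambda v^\lambda+H[v^\lambda]=0$ has a unique solution $v^\lambda$, which is Lipschitz. For a collection $\nu=(\nu_i)_{i\in\mathbb I}$ of nonnegative (finite) Borel measures on $\mathbb T^n\times\Xi$ (equivalently, a nonnegative Borel measure on $\mathbb T^n\times\Xi\times\mathbb I$) and $\phi\in C(\mathbb T^n\times\Xi)^m$, $\langle\nu,\phi\rangle=\sum_{i\in\mathbb I}\int_{\mathbb T^n\times\Xi}\phi_i(x,\xi)\,\nu_i(dx,d\xi)$; functions of $x$ alone are viewed as functions of $(x,\xi)$. For $\lambda\ge 0$, $\mathcal F(\lambda)$ is the set of all $(\phi,u)\in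 C(\mathbb T^n\times\Xi)^m\times C(\mathbb T^n)^m$ such that $u$ is a subsolution of $B^\lambda u+H_\phi[u]=0$ in $\mathbb T^n$. For $\lambda>0$, $\mathbb P_{B^\lambda}$ is the set of collections $\nu=(\nu_i)_{i\in\mathbb I}$ of nonnegative Borel measures on $\mathbb T^n\times\Xi$ with $\langle\nu,B^\lambda\mathbf 1\rangle=1$. For $(z,k)\in\mathbb T^n\times\mathbb I$, $$\mathcal G(z,k,\lambda)=\{\phi-u_k(z)B^\lambda\mathbf 1 : (\phi,u)\in\mathcal F(\lambda)\}\subset C(\mathbb T^n\times\Xi)^m,$$ $$\mathcal G'(z,k,\lambda)=\{\nu\in\mathbb P_{B^\lambda} : \langle\nu,f\rangle\ge0\ \text{for all } f\in\mathcal G(z,k,\lambda)\}.$$ *)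

(* Defs.v *)
From HB Require Import structures.
From mathcomp Require Import all_boot all_order all_algebra.
From mathcomp Require Import generic_quotient.
From mathcomp Require Import all_classical all_reals all_analysis.

Set Implicit Arguments.
Unset Strict Implicit.
Unset Printing Implicit Defensive.

Import Order.TTheory GRing.Theory Num.Theory.
Import numFieldNormedType.Exports.

Local Open Scope classical_set_scope.
Local Open Scope quotient_scope.
Local Open Scope ring_scope.

(* Nonempty metric spaces; the distinguished point only witnesses nonemptiness,
   which measurable types require. *)
#[short(type="pmetricType")]
HB.structure Definition PointedMetric (K : numDomainType) :=
  { M of Metric K M & PseudoPointedMetric K M }.

Section torus.
Context (R : realType) (n : nat).

Definition torus_rel_def (x y : 'rV[R]_n) : bool :=
  [forall j, x ord0 j - y ord0 j \is a Num.int].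

Lemma torus_rel_refl : reflexive torus_rel_def.
Proof. by move=> x; apply/forallP => j; rewrite subrr rpred0. Qed.

Lemma torus_rel_sym : symmetric torus_rel_def.
Proof.
by move=> x y; apply: eq_forallb => j; rewrite -(rpredN _ (x _ _ - _)) opprB.
Qed.

Lemma torus_rel_trans : transitive torus_rel_def.
Proof.
move=> y x z /forallP xy /forallP yz; apply/forallP => j.
by rewrite -(subrKA (y ord0 j)) rpredD.
Qed.

Definition torus_rel :=
  EquivRel torus_rel_def torus_rel_refl torus_rel_sym torus_rel_trans.

(* The flat torus R^n / Z^n with the quotient topology. *)
Definition torus := {eq_quot torus_rel}.

HB.instance Definition _ := PointedTopological.copy torus
  (quotient_topology torus).
HB.instance Definition _ := Quotient.on torus.

End torus.

(* [T * U] keeps its product topology. *)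
HB.instance Definition _ (T U : ptopologicalType) := Pointed.on (T * U)%type.

Section borel.
Context (T : ptopologicalType).

Definition borel := g_sigma_algebraType (@open T).

HB.instance Definition _ := Measurable.on borel.

End borel.

Section vectors.
Context (R : realType).

Definition dotp n (p q : 'rV[R]_n) : R := \sum_j p ord0 j * q ord0 j.

Definition enorm n (p : 'rV[R]_n) : R := Num.sqrt (dotp p p).

Definition monotone_matrix m (A : 'M[R]_m) : Prop :=
  forall (u : 'cV[R]_m) (k : 'I_m),
    (forall i, u i ord0 <= u k ord0) -> 0 <= u k ord0 ->
    0 <= (A *m u) k ord0.

End vectors.

Section C1_torus.
Context (R : realType) (n : nat).

Definition periodic_lift (psi : torus R n -> R) : 'rV[R]_n -> R :=
  fun y => psi (\pi_(torus R n) y).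

Definition gradient (f : 'rV[R]_n -> R) (y : 'rV[R]_n) : 'rV[R]_n :=
  \row_j 'D_(delta_mx ord0 j) f y.

Definition C1 (psi : torus R n -> R) : Prop :=
  (forall y, differentiable (periodic_lift psi) y) /\
  continuous (gradient (periodic_lift psi)).

(* [periodic_lift psi] is Z^n-periodic, so its gradient at a lift of [x] does
   not depend on the chosen representative. *)
Definition Dtorus (psi : torus R n -> R) (x : torus R n) : 'rV[R]_n :=
  gradient (periodic_lift psi) (repr x).

End C1_torus.

Section viscosity.
Context (R : realType) (m n : nat).
Implicit Types (A : torus R n -> 'M[R]_m) (u : 'I_m -> torus R n -> R)
  (F : 'I_m -> torus R n -> 'rV[R]_n -> R).

Definition mxact A u : 'I_m -> torus R n -> R :=
  fun i x => \sum_j A x i j * u j x.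

Definition shift_mx (lambda : R) A : torus R n -> 'M[R]_m :=
  fun x => lambda%:M + A x.

Definition ones : 'I_m -> torus R n -> R := fun _ _ => 1.

Definition subsolution A F u : Prop :=
  (forall i, continuous (u i)) /\
  forall (i : 'I_m) (psi : torus R n -> R) (x : torus R n),
    C1 psi -> (forall y, u i y - psi y <= u i x - psi x) ->
    mxact A u i x + F i x (Dtorus psi x) <= 0.

Definition supersolution A F u : Prop :=
  (forall i, continuous (u i)) /\
  forall (i : 'I_m) (psi : torus R n -> R) (x : torus R n),
    C1 psi -> (forall y, u i x - psi x <= u i y - psi y) ->
    0 <= mxact A u i x + F i x (Dtorus psi x).

Definition solution A F u : Prop := subsolution A F u /\ supersolution A F u.

(* On the compact torus the infimum below is the minimum when [F i] is
   continuous. *)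
Definition coercive F : Prop :=
  forall (i : 'I_m) (M : R), exists r : R, forall p : 'rV[R]_n,
    r <= enorm p -> M <= inf (range (fun x => F i x p)).

End viscosity.

Section measures.
Context (R : realType) (m n : nat) (Xi : pmetricType R).
Implicit Types (g : 'I_m -> torus R n * Xi -> 'rV[R]_n)
  (phi : 'I_m -> torus R n * Xi -> R) (B : torus R n -> 'M[R]_m)
  (nu : 'I_m -> {finite_measure set (borel (torus R n * Xi)%type) -> \bar R}).

(* The supremum is the maximum over [xi] when [g], [phi] are continuous and [Xi]
   is compact. *)
Definition hamiltonian g phi : 'I_m -> torus R n -> 'rV[R]_n -> R :=
  fun i x p => sup (range (fun xi : Xi => - dotp (g i (x, xi)) p - phi i (x, xi))).

Definition pairing nu phi : R :=
  \sum_(i < m) Rintegral (nu i) setT (phi i).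

Definition Fset g B (lambda : R) :
    set (('I_m -> torus R n * Xi -> R) * ('I_m -> torus R n -> R)) :=
  [set pu | (forall i, continuous (pu.1 i)) /\
            subsolution (shift_mx lambda B) (hamiltonian g pu.1) pu.2].

(* (B^lambda 1)_i, viewed as a function on T^n x Xi. *)
Definition Bones B (lambda : R) : 'I_m -> torus R n * Xi -> R :=
  fun i y => mxact (shift_mx lambda B) (@ones R m n) i y.1.

Definition Pset B (lambda : R) :
    set ('I_m -> {finite_measure set (borel (torus R n * Xi)%type) -> \bar R}) :=
  [set nu | pairing nu (Bones B lambda) = 1].

Definition Gset g B (z : torus R n) (k : 'I_m) (lambda : R) :
    set ('I_m -> torus R n * Xi -> R) :=
  [set (fun i y => pu.1 i y - pu.2 k z * Bones B lambda i y)
    | pu in Fset g B lambda].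

Definition Gdual g B (z : torus R n) (k : 'I_m) (lambda : R) :
    set ('I_m -> {finite_measure set (borel (torus R n * Xi)%type) -> \bar R}) :=
  [set nu | Pset B lambda nu /\
            forall f, Gset g B z k lambda f -> 0 <= pairing nu f].

End measures.

(* Main.v *)
Require Import Defs.
From HB Require Import structures.
From mathcomp Require Import all_boot all_order all_algebra.
From mathcomp Require Import generic_quotient.
From mathcomp Require Import all_classical all_reals all_analysis.
From mathcomp Require Import measurable_realfun ring lra.

(** The measure is obtained by duality.  Consider the pairs [(phi, c)] with
    [c = u_k(z)] and [(phi, u)] in [F(lambda)], together with the multiples of
    [(- L, - v_k(z))].  They generate a convex cone, and what is wanted is a
    positive linear functional [l] with [c <= l(phi)] on that cone.  Such an [l]
    does everything at once: [(L, v)] and [(- L, - v)] give [l(L) = v_k(z)];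
    since the constant vectors [c 1] are subsolutions for the costs
    [c B^lambda 1], the values [c = 1] and [c = -1] give [l(B^lambda 1) = 1]; and
    the inequality on the remaining pairs is the membership in [G'(z,k,lambda)].

    By Hahn-Banach ([positive_functional_of_cone]) the functional exists provided
    that [phi <= 0] forces [c <= 0] on the cone.  Spelled out: if [u] is a
    subsolution for a cost [phi <= t L], then [u_k(z) <= t v_k(z)].  Adding
    [(L, v)] and dividing by [t + 1] turns [u] into a subsolution for [L], and
    the comparison principle concludes.  This uses that the pairs
    [(phi, u)] form a convex cone, which is where the convexity of the
    Hamiltonian in [(phi, p)] enters.

    Both [comparison] and the stability of subsolutions under sums
    ([subsolutionD]) come from one doubling of variables, [fuzzy_sum_rule]: if
    [a + b - psi] has a maximum at [x0], then near [x0] there are points where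
    [a] and [b] are touched by test functions whose gradients add up
    to nearly [D psi(x0)].  Coercivity keeps these gradients bounded, so that
    one may pass to the limit without any regularity theory for subsolutions.

    It remains to represent the functional by measures
    ([riesz_representation]).  Hahn-Banach is applied on all bounded functions,
    so the functional gives a finitely additive content on all subsets.  On the
    space of ultrafilters this content lives on clopen sets, where compactness
    makes it countably additive for free; the extended measure is then
    transported by the map sending an ultrafilter to its limit. *)

Set Implicit Arguments.
Unset Strict Implicit.
Unset Printing Implicit Defensive.

Import Order.TTheory GRing.Theory Num.Theory.
Import numFieldNormedType.Exports.

Local Open Scope classical_set_scope.
Local Open Scope quotient_scope.
Local Open Scope ring_scope.

(** * Hahn-Banach for cones of functions *)

Section dominated_linear.
Context (R : realType) (V : lmodType R) (D : set V).
Context (D_add : forall x y, D x -> D y -> D (x + y)).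
Context (D_scale : forall (t : R) x, D x -> D (t *: x)).

(** Everything is relative to the subspace [D]: the functionals of interest are
    only under control on bounded functions. *)
Definition sublinear_on (q : V -> R) :=
  (forall x y, D x -> D y -> q (x + y) <= q x + q y) /\
  (forall t x, 0 < t -> D x -> q (t *: x) <= t * q x).

Let D_opp x : D x -> D (- x).
Proof. by move=> Dx; rewrite -scaleN1r; exact: D_scale. Qed.

Let D_zero x : D x -> D 0.
Proof. by move=> Dx; rewrite -(scale0r x); exact: D_scale. Qed.

Lemma sublinear_onZ q t x : sublinear_on q -> 0 < t -> D x ->
  q (t *: x) = t * q x.
Proof.
move=> [_ qZ] t0 Dx; apply/eqP; rewrite eq_le qZ//=.
have := qZ t^-1 (t *: x); rewrite invr_gt0 scalerA mulVf ?gt_eqF// scale1r.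
by move=> /(_ t0 (D_scale _ Dx)); rewrite ler_pdivlMl.
Qed.

Lemma sublinear_on0 q : sublinear_on q -> D 0 -> q 0 = 0.
Proof.
move=> qs D0; have := sublinear_onZ (t := 2) qs (ltr0Sn _ _) D0.
by rewrite scaler0; lra.
Qed.

Lemma sublinear_on_opp q x : sublinear_on q -> D x -> - q (- x) <= q x.
Proof.
move=> qs Dx; have := qs.1 _ _ Dx (D_opp Dx).
by rewrite subrr (sublinear_on0 qs (D_zero Dx)); lra.
Qed.

(** Of two members of a chain the smaller one may be used for both summands,
    which is why subadditivity survives the infimum; the values at [x] stay above
    [- p (- x)]. *)
Lemma sublinear_on_chain_inf p (A : set (V -> R)) : A !=set0 ->
  (forall q, A q -> sublinear_on q /\ forall x, D x -> q x <= p x) ->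
  (forall q r, A q -> A r -> (forall x, D x -> q x <= r x) \/
                             (forall x, D x -> r x <= q x)) ->
  let l := fun x => inf [set q x | q in A] in
  sublinear_on l /\ forall q x, A q -> D x -> l x <= q x.
Proof.
move=> [q0 Aq0] Asub Atot l.
have lb x : D x -> has_lbound [set q x | q in A].
  move=> Dx; exists (- p (- x)) => _ [q Aq <-].
  have [qs qp] := Asub _ Aq.
  apply: le_trans (sublinear_on_opp qs Dx).
  by rewrite lerN2; apply/qp/D_opp.
have lle q x : A q -> D x -> l x <= q x.
  by move=> Aq Dx; apply: ge_inf; [exact: lb|exists q].
have lge x c : (forall q, A q -> c <= q x) -> c <= l x.
  by move=> H; apply: lb_le_inf; [exists (q0 x), q0|move=> _ [q Aq <-]; exact: H].
split => //; split=> [x y Dx Dy|t x t0 Dx].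
  rewrite -lerBlDr; apply: (lge _ _) => q Aq; rewrite lerBlDr -lerBlDl.
  apply: (lge _ _) => r Ar; rewrite lerBlDl.
  have [qr|rq] := Atot _ _ Aq Ar.
  + apply: (le_trans (lle _ _ Aq (D_add Dx Dy))).
    apply: (le_trans ((Asub _ Aq).1.1 _ _ Dx Dy)).
    by rewrite lerD2l qr.
  + apply: (le_trans (lle _ _ Ar (D_add Dx Dy))).
    apply: (le_trans ((Asub _ Ar).1.1 _ _ Dx Dy)).
    by rewrite lerD2r rq.
rewrite -ler_pdivrMl//; apply: (lge _ _) => q Aq; rewrite ler_pdivrMl//.
apply: (le_trans (lle _ _ Aq (D_scale _ Dx))).
exact: (Asub _ Aq).1.2.
Qed.

(** This functional lies below [q] and makes [q] additive in the direction [x]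
    when it coincides with [q]: the parameter [t = 1] then gives
    [q y + q x <= q (y + x)]. *)
Lemma sublinear_on_inf_shift q x : sublinear_on q -> D x ->
  let l := fun y => inf [set q (y + t *: x) - t * q x | t in [set t : R | 0 <= t]] in
  sublinear_on l /\ forall (t : R) y, 0 <= t -> D y -> l y <= q (y + t *: x) - t * q x.
Proof.
move=> qs Dx l.
have qZ0 (t : R) : 0 <= t -> q (t *: x) = t * q x.
  rewrite le_eqVlt => /predU1P[<-|t0]; last exact: sublinear_onZ.
  by rewrite scale0r mul0r (sublinear_on0 qs (D_zero Dx)).
have Dtx t y : D y -> D (y + t *: x).
  by move=> Dy; apply: D_add => //; exact: D_scale.
have lb y : D y ->
    has_lbound [set q (y + t *: x) - t * q x | t in [set t : R | 0 <= t]].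
  move=> Dy; exists (- q (- y)) => _ [t /= t0 <-].
  have := qs.1 _ _ (Dtx t y Dy) (D_opp Dy).
  by rewrite addrAC subrr add0r qZ0//; lra.
have lle (t : R) y : 0 <= t -> D y -> l y <= q (y + t *: x) - t * q x.
  by move=> t0 Dy; apply: ge_inf; [exact: lb|exists t].
have lge y c : (forall t, 0 <= t -> c <= q (y + t *: x) - t * q x) -> c <= l y.
  move=> H; apply: lb_le_inf; last by move=> _ [t t0 <-]; exact: H.
  by exists (q (y + 0 *: x) - 0 * q x); exists 0 => /=.
split => //; split=> [y y' Dy Dy'|s y s0 Dy].
  rewrite -lerBlDr; apply: (lge _ _) => t t0; rewrite lerBlDr -lerBlDl.
  apply: (lge _ _) => t' t'0; rewrite lerBlDl.
  apply: (le_trans (lle (t + t') _ (addr_ge0 t0 t'0) (D_add Dy Dy'))).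
  have := qs.1 _ _ (Dtx t y Dy) (Dtx t' y' Dy').
  by rewrite addrACA -scalerDl; lra.
rewrite -ler_pdivrMl//; apply: (lge _ _) => t t0; rewrite ler_pdivrMl//.
apply: (le_trans (lle (s * t) _ (mulr_ge0 (ltW s0) t0) (D_scale _ Dy))).
have := qs.2 _ _ s0 (Dtx t y Dy).
by rewrite scalerDr scalerA; lra.
Qed.

(** A minimal sublinear functional below [p], which Zorn provides, is linear,
    because by [sublinear_on_inf_shift] it cannot be lowered in any direction. *)
Lemma dominated_linear p : sublinear_on p ->
  exists l : V -> R, [/\ forall x y, D x -> D y -> l (x + y) = l x + l y,
    forall t x, D x -> l (t *: x) = t * l x & forall x, D x -> l x <= p x].
Proof.
move=> ps.
pose P q := sublinear_on q /\ forall x, D x -> q x <= p x.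
pose T := {q : V -> R | P q}.
pose t0 : T := exist P p (conj ps (fun x _ => lexx (p x))).
pose r (q q' : T) := `[< forall x, D x -> sval q' x <= sval q x >].
have rP q q' : reflect (forall x, D x -> sval q' x <= sval q x) (r q q').
  exact: asboolP.
have [|||q qmin] := @ZL_preorder T t0 r.
- by move=> q; apply/rP.
- move=> q1 q2 q3 /rP h1 /rP h2; apply/rP => x Dx.
  exact: le_trans (h2 _ Dx) (h1 _ Dx).
- move=> A Atot; have [[q Aq]|A0] := pselect (A !=set0); last first.
    by exists t0 => s As; exfalso; apply: A0; exists s.
  have [|||ls lle] := @sublinear_on_chain_inf p (sval @` A).
  + by exists (sval q), q.
  + by move=> _ [s As <-]; exact: (svalP s).
  + move=> _ _ [s As <-] [s' As' <-].
    by case: (Atot _ _ As As') => /rP; [right|left].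
  have lp x : D x -> inf [set q x | q in sval @` A] <= p x.
    move=> Dx; apply: (le_trans (lle (sval q) _ _ Dx)); first by exists q.
    exact: (svalP q).2.
  exists (exist P _ (conj ls lp)) => s As; apply/rP => x Dx /=.
  by apply: lle => //; exists s.
have [qs qp] := svalP q.
have qD x y : D x -> D y -> sval q (x + y) = sval q x + sval q y.
  move=> Dx Dy; apply/eqP; rewrite eq_le qs.1//=.
  have [ls lle] := sublinear_on_inf_shift qs Dx.
  have lq w : D w ->
      inf [set sval q (w + t *: x) - t * sval q x | t in [set t : R | 0 <= t]] <=
      sval q w.
    by move=> Dw; have := lle 0 w (lexx 0) Dw; rewrite scale0r mul0r addr0 subr0.
  pose s : T := exist P _ (conj ls (fun w Dw => le_trans (lq w Dw) (qp w Dw))).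
  have /rP/(_ y Dy) /= : r s q by apply: qmin; apply/rP.
  have := lle 1 y ler01 Dy; rewrite scale1r mul1r [y + x]addrC; lra.
have q0 x : D x -> sval q 0 = 0 by move=> /D_zero; exact: sublinear_on0.
have qN x : D x -> sval q (- x) = - sval q x.
  move=> Dx; have := qD _ _ Dx (D_opp Dx); rewrite subrr (q0 x)//; lra.
exists (sval q); split => // t x Dx.
have [t_gt0|t_lt0|->] := ltrgt0P t.
- exact: sublinear_onZ.
- rewrite -[t]opprK scaleNr qN; last exact: D_scale.
  by rewrite (sublinear_onZ qs)// ?mulNr// oppr_gt0.
- by rewrite scale0r mul0r (q0 x).
Qed.

End dominated_linear.

Definition bounded_real (R : realType) (Y : Type) (f : Y -> R) :=
  exists M, forall y, `|f y| <= M.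

(** The functional is any linear one below
    [f |-> inf {- c | (h, c) in C, h <= - f}].  An element of the cone with
    [h <= -1] makes this infimum range over a nonempty set for bounded [f]; the
    last hypothesis, after adding a multiple of that element, bounds it from
    below. *)
Lemma positive_functional_of_cone (R : realType) (Y : Type)
    (C : set ((Y -> R) * R)) :
  (forall h c h' c', C (h, c) -> C (h', c') -> C (h + h', c + c')) ->
  (forall t h c, 0 <= t -> C (h, c) -> C (t *: h, t * c)) ->
  (exists h c, C (h, c) /\ forall y, h y <= -1) ->
  (forall h c, C (h, c) -> (forall y, h y <= 0) -> c <= 0) ->
  exists l : (Y -> R) -> R,
    [/\ forall f g, bounded_real f -> bounded_real g -> l (f + g) = l f + l g,
        forall t f, bounded_real f -> l (t *: f) = t * l f,
        forall f, bounded_real f -> (forall y, 0 <= f y) -> 0 <= l f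
      & forall h c, bounded_real h -> C (h, c) -> c <= l h].
Proof.
move=> CD CZ [h1 [c1 [Ch1 h1le]]] C0.
have CZ0 : C (0, 0) by have := CZ 0 _ _ (lexx 0) Ch1; rewrite scale0r mul0r.
(* The sign conventions turn the superlinear supremum of the [c] into a
   sublinear infimum. *)
pose S f := [set - hc.2 | hc in [set hc | C hc /\ forall y, hc.1 y <= - f y]].
pose p (f : Y -> R) := inf (S f).
have S0 f : bounded_real f -> S f !=set0.
  move=> [M fM]; pose N := Num.max M 0.
  have N0 : 0 <= N by rewrite le_max lexx orbT.
  exists (- (N * c1)), (N *: h1, N * c1) => //=; split; first exact: CZ.
  move=> y; rewrite fctE /=; have := h1le y.
  have : f y <= N by rewrite le_max (le_trans (ler_norm _) (fM y)).
  move=> fN h1y; apply: (@le_trans _ _ (N * -1)); first exact: ler_wpM2l.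
  by rewrite mulrN1 lerN2.
have Slb f : bounded_real f -> has_lbound (S f).
  move=> [M fM]; pose N := Num.max M 0.
  have N0 : 0 <= N by rewrite le_max lexx orbT.
  exists (N * c1) => _ [[h c] /= [Chc hf] <-].
  rewrite -subr_le0 opprK; apply: (C0 (N *: h1 + h)).
    by apply: CD => //; exact: CZ.
  move=> y.
  have : - f y <= N.
    by rewrite le_max (le_trans _ (fM y))// -normrN ler_norm.
  have : N * h1 y <= N * -1 by apply: ler_wpM2l.
  by have := hf y => /=; rewrite (_ : (N *: h1 + h) y = N * h1 y + h y)//; lra.
have ple f hc : bounded_real f -> C hc -> (forall y, hc.1 y <= - f y) ->
    p f <= - hc.2.
  by move=> bf Chc hf; apply: ge_inf; [exact: Slb|exists hc].
have pge f a : bounded_real f -> (forall hc, C hc -> (forall y, hc.1 y <= - f y) ->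
    a <= - hc.2) -> a <= p f.
  move=> bf H; apply: lb_le_inf; first exact: S0.
  by move=> _ [hc [Chc hf] <-]; exact: H.
have bD (f g : Y -> R) : bounded_real f -> bounded_real g -> bounded_real (f + g).
  move=> [M fM] [N gN]; exists (M + N) => y.
  by rewrite fctE (le_trans (ler_normD _ _))// lerD.
have bZ t (f : Y -> R) : bounded_real f -> bounded_real (t *: f).
  move=> [M fM]; exists (`|t| * M) => y.
  by rewrite fctE normrM ler_wpM2l.
have ps : sublinear_on (@bounded_real R Y) p.
  split=> [f g bf bg|t f t0 bf].
    rewrite -lerBlDr; apply: (pge _ _) => // -[h c] Chc hf; rewrite lerBlDr -lerBlDl.
    apply: (pge _ _) => // -[h' c'] Chc' hg; rewrite lerBlDl /=.
    rewrite -opprD; apply: (ple _ (h + h', c + c')); [exact: bD|exact: CD|].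
    by move=> y /=; rewrite !fctE opprD lerD.
  rewrite -ler_pdivrMl//; apply: (pge _ _) => // -[h c] Chc hf; rewrite ler_pdivrMl//.
  rewrite mulrN; apply: (ple _ (t *: h, t * c)); [exact: bZ|exact/CZ/Chc/ltW|].
  by move=> y /=; rewrite !fctE /= -mulrN ler_wpM2l// ltW.
have [l [lD lZ lp]] := dominated_linear bD bZ ps.
have lN f : bounded_real f -> l (- f) = - l f.
  by move=> bf; rewrite -scaleN1r lZ// mulN1r.
have bN (f : Y -> R) : bounded_real f -> bounded_real (- f).
  by move=> bf; rewrite -scaleN1r; exact: bZ.
exists l; split => // [f bf f0|h c bh Chc].
  rewrite -oppr_le0 -lN//; apply: le_trans (lp _ (bN _ bf)) _.
  rewrite -[leRHS]oppr0; apply: (ple _ (0, 0)) => //; first exact: bN.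
  by move=> y; rewrite /= opprK.
rewrite -lerN2 -lN//; apply: le_trans (lp _ (bN _ bh)) _.
apply: (ple _ (h, c)) => //; first exact: bN.
by move=> y; rewrite /= opprK.
Qed.

(** * Riesz representation through ultrafilters *)

(** The Stone-Cech compactification of [X] with the discrete topology. *)
Record stone (X : Type) := Stone {
  stone_filter :> set_system X;
  stone_ultra : UltraFilter stone_filter }.

#[global] Existing Instance stone_ultra.

Definition stone_point (X : Type) (x : X) : stone X :=
  Stone (principal_filter_ultra x).

Definition stone_clopen (X : Type) (A : set X) : set (stone X) :=
  [set w : stone X | stone_filter w A].

Section stone_space.
Context (X : pointedType).

HB.instance Definition _ := gen_eqMixin (stone X).
HB.instance Definition _ := gen_choiceMixin (stone X).
HB.instance Definition _ := isPointed.Build (stone X) (stone_point point).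

Lemma stone_clopen0 : stone_clopen (@set0 X) = set0.
Proof. by apply/seteqP; split => w //= /filter_ex[]. Qed.

Lemma stone_clopenC (A : set X) : stone_clopen (~` A) = ~` stone_clopen A.
Proof.
apply/seteqP; split => w /=.
  by move=> wAC wA; have /filter_ex[x []] : stone_filter w (A `&` ~` A) by exact: filterI.
by move=> nwA; have [//|] := in_ultra_setVsetC A (stone_ultra w).
Qed.

Lemma stone_clopenI (A B : set X) :
  stone_clopen (A `&` B) = stone_clopen A `&` stone_clopen B.
Proof.
apply/seteqP; split => w /=.
  by move=> wAB; split; apply: filterS wAB => x [].
by move=> [wA wB]; exact: filterI.
Qed.

Lemma stone_clopenU (A B : set X) :
  stone_clopen (A `|` B) = stone_clopen A `|` stone_clopen B.
Proof.
by rewrite -[A `|` B]setCK setCU stone_clopenC stone_clopenI !stone_clopenC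
  setCI !setCK.
Qed.

Lemma stone_clopen_inj : injective (@stone_clopen X).
Proof.
move=> A B AB; apply/seteqP; split => x.
- move=> Ax; have : stone_clopen A (stone_point x) by apply/principal_filterP.
  by rewrite AB => /principal_filterP.
- move=> Bx; have : stone_clopen B (stone_point x) by apply/principal_filterP.
  by rewrite -AB => /principal_filterP.
Qed.

Definition clopens : set (set (stone X)) := range (@stone_clopen X).

Let clopens0 : clopens set0.
Proof. by exists set0 => //; exact: stone_clopen0. Qed.

Let clopensU : setU_closed clopens.
Proof. by move=> _ _ [A _ <-] [B _ <-]; exists (A `|` B); rewrite ?stone_clopenU. Qed.

Let clopensC : setC_closed clopens.
Proof. by move=> _ [A _ <-]; exists (~` A); rewrite ?stone_clopenC. Qed.

HB.instance Definition _ := @isAlgebraOfSets.Build default_measure_display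
  (stone X) clopens clopens0 clopensU clopensC.

(** Compactness of a clopen set, in the form used for countable additivity: if
    no finite union suffices, an ultrafilter containing all the differences [D n]
    belongs to the clopen set of the union but to none of those of the [A n]. *)
Lemma stone_compact (A : nat -> set X) :
  stone_clopen (\bigcup_n A n) `<=` \bigcup_n stone_clopen (A n) ->
  exists n, \bigcup_n A n `<=` \big[setU/set0]_(i < n) A i.
Proof.
move=> sub; apply: contrapT => nofin.
pose D n := (\bigcup_n A n) `\` \big[setU/set0]_(i < n) A i.
have Dle i j : (i <= j)%N -> D j `<=` D i.
  by move=> ij; apply: setDS; exact: subset_bigsetU.
have D0 n : D n !=set0.
  apply: contrapT => Dn; apply: nofin; exists n => x Ax.
  by apply: contrapT => nx; apply: Dn; exists x.
have FF : ProperFilter (filter_from setT D).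
  apply: filter_from_proper; last by move=> n _; exact: D0.
  apply: filter_fromT_filter; first by exists 0%N.
  move=> i j; exists (maxn i j) => x Dx; split; apply: Dle Dx.
    exact: leq_maxl.
  exact: leq_maxr.
have [w [wU Fw]] := ultraFilterLemma FF.
have wD n : w (D n) by apply: Fw; exists n.
have [|n _ /= wn] := sub (Stone wU).
  by apply: filterS (wD 0%N) => x [].
have /filter_ex[x [Ax [_ nx]]] : w (A n `&` D n.+1) by exact: filterI.
by apply: nx; rewrite big_ord_recr /=; right.
Qed.

End stone_space.

(** A disjoint countable union of clopen sets that is clopen is a finite union,
    so finite additivity is countable additivity there and the Caratheodory
    extension applies. *)
Lemma stone_measure (R : realType) (X : pointedType) (m : set X -> R) :
  (forall A, 0 <= m A) ->
  (forall A B, A `&` B = set0 -> m (A `|` B) = m A + m B) ->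
  exists mu : {measure set (g_sigma_algebraType (@measurable _ (stone X))) -> \bar R},
    forall A, mu (stone_clopen A) = (m A)%:E.
Proof.
move=> m_ge0 mD.
have m0 : m set0 = 0 by have := mD set0 set0; rewrite setI0 setU0 => /(_ erefl); lra.
pose c (S : set (stone X)) := (m [set x | S (stone_point x)])%:E.
have cE A : c (stone_clopen A) = (m A)%:E.
  congr (m _)%:E; apply/seteqP; split => x /=; first by move/principal_filterP.
  by move=> Ax; apply/principal_filterP.
have c0 : c set0 = 0%E by rewrite -(stone_clopen0 X) cE m0.
have c_ge0 S : (0 <= c S)%E by rewrite lee_fin.
have cS : semi_sigma_additive (c : set (stone X) -> \bar R).
  move=> F mF tF [U _ UF].
  have /choice[A FA] : forall n, exists B, F n = stone_clopen B.
    by move=> n; have [B _ <-] := mF n; exists B.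
  have {}tA : trivIset setT A.
    apply/trivIsetP => i j _ _ ij; apply: stone_clopen_inj.
    rewrite stone_clopenI stone_clopen0 -!FA.
    by move/trivIsetP : tF; apply.
  have UE : U = \bigcup_n A n.
    apply/seteqP; split => x.
    - move=> Ux; have : stone_clopen U (stone_point x) by apply/principal_filterP.
      by rewrite UF => -[n _]; rewrite FA => /principal_filterP; exists n.
    - move=> [n _ Anx]; suff : stone_clopen U (stone_point x) by move/principal_filterP.
      by rewrite UF; exists n => //; rewrite FA; apply/principal_filterP.
  have [|N UN] := @stone_compact _ A.
    by rewrite -UE UF; move=> w [n _]; rewrite FA; exists n.
  rewrite -UF cE.
  apply: cvg_near_cst; exists N => // n /= Nn.
  rewrite (_ : m U = m (\big[setU/set0]_(i < n) A i)); last first.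
    congr m; rewrite UE; apply/seteqP; split.
      by apply: (subset_trans UN); exact: subset_bigsetU.
    by move=> x; rewrite -bigcup_mkord => -[i _ Aix]; exists i.
  rewrite big_mkord; elim: {Nn} n => [|n IH]; first by rewrite !big_ord0 m0.
  rewrite !big_ord_recr /= IH FA cE mD ?EFinD//.
  by apply: (@trivIset_bigsetUI _ xpredT) => //; apply: sub_trivIset tA.
pose cm := isMeasure.Build _ _ _ c c0 c_ge0 cS.
pose M : {measure set (stone X) -> \bar R} := HB.pack c cm.
exists (measure_extension M) => A.
rewrite -cE; apply: (@measurable_mu_extE _ R _ M (stone_clopen A)).
by exists A.
Qed.

(** The sum is [e * min N (floor (t / e))]: a layer-cake approximation of [t]
    from below with error at most [e]. *)
Lemma sum_steps_floor (R : realFieldType) (e t : R) (N : nat) : 0 < e -> 0 <= t ->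
  t <= N%:R * e ->
  \sum_(j < N) (if j.+1%:R * e <= t then e else 0) <= t <=
  \sum_(j < N) (if j.+1%:R * e <= t then e else 0) + e.
Proof.
move=> e0 t0 tN.
pose s n := \sum_(j < n) (if j.+1%:R * e <= t then e else 0).
have sS n : s n.+1 = s n + (if n.+1%:R * e <= t then e else 0).
  by rewrite /s big_ord_recr.
(* The middle clause feeds the induction when [t] crosses the next level. *)
have H n : [/\ s n <= t, (n%:R * e <= t -> s n = n%:R * e)
              & (t <= n%:R * e -> t <= s n + e)].
  elim: n => [|n [IH1 IH2 IH3]].
    by rewrite /s big_ord0 mul0r; split => // h; lra.
  have nS : n.+1%:R * e = n%:R * e + e by rewrite -natr1 mulrDl mul1r.
  rewrite sS; case: ifPn => [le_t|]; last rewrite -ltNge => lt_t.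
    have nt : n%:R * e <= t by lra.
    by rewrite IH2//; split; lra.
  rewrite addr0; split; [exact: IH1|by move=> ?; lra|move=> _].
  have [tn|nt] := leP t (n%:R * e); first exact: IH3.
  by rewrite IH2//; lra.
by have [H1 _ H3] := H N; apply/andP; split => //; exact: H3.
Qed.

Section riesz.
Context (R : realType) (X : ptopologicalType).

Lemma compact_continuous_bounded (f : X -> R) : compact [set: X] ->
  continuous f -> bounded_real f.
Proof.
move=> Xc fc; have : compact (f @` setT).
  by apply: continuous_compact => //; apply: continuous_subspaceT.
move=> /compact_bounded[M [_ MP]]; exists (M + 1) => x.
by apply: (MP (M + 1)); [rewrite ltrDl|exists x].
Qed.

Lemma continuous_borel_measurable (f : X -> R) : continuous f ->
  measurable_fun setT (f : borel X -> R).
Proof.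
move=> fc; apply: (measurability _ (RGenOpens.measurableE R)).
move=> _ [_ [a [b ->] <-]]; rewrite setTI.
apply: sub_sigma_algebra; move/continuousP : fc; apply; exact: interval_open.
Qed.

Context (Xc : compact [set: X]).

Lemma stone_limit_ex (w : stone X) : exists x : X, stone_filter w --> x.
Proof.
move: (Xc); rewrite compact_ultra => /(_ (stone_filter w) _ filterT).
by case=> // x [_ wx]; exists x.
Qed.

(** Limits may fail to be unique; any choice will do, because a continuous real
    function takes the same value at all limits of an ultrafilter. *)
Definition stone_limit (w : stone X) : X := sval (cid (stone_limit_ex w)).

Lemma stone_limitP (w : stone X) : stone_filter w --> stone_limit w.
Proof. by rewrite /stone_limit; case: cid. Qed.

(** If [w] converges to a point of [U], that point lies in some open [V n], hence
    [w] contains [V n]; conversely a limit of [w] containing [V n] is in the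
    closure of [V n].  So the preimage of [U] is a countable union of clopen
    sets. *)
Lemma stone_limit_measurable :
  (forall U : set X, open U -> exists V : nat -> set X,
    [/\ forall n, open (V n), forall n, closure (V n) `<=` U
      & U `<=` \bigcup_n V n]) ->
  measurable_fun setT
   (stone_limit : g_sigma_algebraType (@measurable _ (stone X)) -> borel X).
Proof.
move=> Xfsigma; apply: (@measurability _ _ _ (borel X) setT _ (@open X) erefl).
move=> _ [U oU <-]; rewrite setTI.
have [V [oV VU UV]] := Xfsigma _ oU.
rewrite (_ : stone_limit @^-1` U = \bigcup_n stone_clopen (V n)).
  apply: bigcupT_measurable => n; apply: sub_sigma_algebra.
  by exists (V n).
apply/seteqP; split => w /=.
  move=> /UV[n _ Vn]; exists n => //.
  by apply: stone_limitP; exact: open_nbhs_nbhs.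
move=> [n _ wV]; apply: (VU n) => W Wlim.
have /filter_ex[x [? ?]] : stone_filter w (V n `&` W).
  by apply: filterI => //; exact: stone_limitP.
by exists x.
Qed.

(** An ultrafilter decides membership in each of the finitely many levels
    [A j], so on one of its members the step function of [f] is constant, equal
    to [s]. *)
Lemma stone_limit_step (f : X -> R) (e M : R) (N : nat) (w : stone X)
    (A := fun j : nat => [set x | j.+1%:R * e <= f x + M])
    (s := \sum_(j < N) e * \1_(stone_clopen (A j)) w) :
  continuous f -> 0 < e -> (forall x, `|f x| <= M) -> 2 * M <= N%:R * e ->
  s <= f (stone_limit w) + M <= s + e.
Proof.
move=> fc e0 fM NM.
have near_s : \forall x \near stone_filter w, s <= f x + M <= s + e.
  have : \forall x \near stone_filter w, forall j : 'I_N,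
      (x \in A j) = (w \in stone_clopen (A j)).
    apply: filter_forall => j; have [wA|wA] := boolP (w \in stone_clopen (A j)).
      by move: wA; rewrite inE /= => wA; apply: filterS wA => x /mem_set.
    have : stone_clopen (~` A j) w.
      by rewrite stone_clopenC => wAj; move: wA; rewrite (mem_set wAj).
    by rewrite /= => wAC; apply: filterS wAC => x; exact: memNset.
  apply: filterS => x xA.
  have := @sum_steps_floor _ e (f x + M) N e0.
  rewrite -lerBlDr sub0r; have /ler_normlP[fMx Mfx] := fM x.
  rewrite lerNl => /(_ fMx) h; have {}h := h _.
  rewrite (_ : s = \sum_(j < N) (if j.+1%:R * e <= f x + M then e else 0)).
    by apply: h; lra.
  apply: eq_bigr => j _; rewrite indicE -xA.
  case: ifPn => [/mem_set|] Ax.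
    by rewrite (_ : x \in A j) ?mulr1.
  by rewrite memNset ?mulr0//; exact/negP.
have flim : (f x + M) @[x --> stone_filter w] --> f (stone_limit w) + M.
  apply: cvgD; last exact: cvg_cst.
  by apply: cvg_trans (fc _); apply: cvg_app; exact: stone_limitP.
have FF : ProperFilter (stone_filter w) by exact: ultra_proper.
have near_ge : \forall x \near stone_filter w, s <= f x + M.
  by apply: filterS near_s => x /andP[].
have near_le : \forall x \near stone_filter w, f x + M <= s + e.
  by apply: filterS near_s => x /andP[].
apply/andP; split.
- exact: (closed_cvg _ (@closed_ge R s) near_ge _ flim).
- exact: (closed_cvg _ (@closed_le R (s + e)) near_le _ flim).
Qed.

(** With [m A] the value of [L] at the indicator of [A], both [L f] and the
    integral of [f] along the limit map, shifted by the same constant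
    [M * m setT], lie within [e * m setT] of the common value of the step
    functions with levels [A j] and with levels
    [stone_clopen (A j)]. *)
Theorem riesz_representation (L : (X -> R) -> R) :
  (forall U : set X, open U -> exists V : nat -> set X,
    [/\ forall n, open (V n), forall n, closure (V n) `<=` U
      & U `<=` \bigcup_n V n]) ->
  (forall f g, bounded_real f -> bounded_real g -> L (f + g) = L f + L g) ->
  (forall t f, bounded_real f -> L (t *: f) = t * L f) ->
  (forall f, bounded_real f -> (forall x, 0 <= f x) -> 0 <= L f) ->
  exists nu : {finite_measure set (borel X) -> \bar R},
    forall f, continuous f -> L f = Rintegral nu setT f.
Proof.
move=> Xfsigma LD LZ L_ge0.
have bI (A : set X) : bounded_real (\1_A : X -> R).
  by exists 1 => x; rewrite indicE; case: (x \in A); rewrite /= ?normr1 ?normr0.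
have bD (f g : X -> R) : bounded_real f -> bounded_real g -> bounded_real (f + g).
  move=> [M fM] [N gN]; exists (M + N) => y.
  by rewrite fctE (le_trans (ler_normD _ _))// lerD.
have bZ t (f : X -> R) : bounded_real f -> bounded_real (t *: f).
  move=> [M fM]; exists (`|t| * M) => y.
  by rewrite fctE normrM ler_wpM2l.
have L_le (f g : X -> R) : bounded_real f -> bounded_real g ->
    (forall x, f x <= g x) -> L f <= L g.
  move=> bf bg fg; have := L_ge0 (g + (-1) *: f) (bD _ _ bg (bZ _ _ bf)).
  rewrite LD ?LZ//; last exact: bZ.
  rewrite mulN1r subr_ge0; apply => x.
  by rewrite fctE /= scaleN1r subr_ge0.
pose m (A : set X) := L \1_A.
have m_ge0 A : 0 <= m A by apply: L_ge0 => // x; rewrite indicE ler0n.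
have mD A B : A `&` B = set0 -> m (A `|` B) = m A + m B.
  move=> AB0; rewrite /m -LD//; congr L; apply/funext => x.
  rewrite fctE !indicE in_setU.
  have [xA|xA] := boolP (x \in A); have [xB|xB] := boolP (x \in B);
    rewrite /= ?addr0 ?add0r//.
  suff : set0 x by [].
  by rewrite -AB0; split; apply: set_mem.
have [mu muE] := stone_measure m_ge0 mD.
have muT : mu setT = (m setT)%:E.
  rewrite -muE; congr (mu _); apply/seteqP; split => w //= _.
  exact: filterT.
have mq := stone_limit_measurable Xfsigma.
pose nu0 : set (borel X) -> \bar R := pushforward mu
  (stone_limit : g_sigma_algebraType (@measurable _ (stone X)) -> borel X).
have nu0_0 : nu0 set0 = 0%E by rewrite /nu0 /pushforward preimage_set0 measure0.
have nu0_ge0 A : (0 <= nu0 A)%E by exact: measure_ge0.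
have nu0_sa : semi_sigma_additive nu0.
  by apply: measure_semi_sigma_additive.
pose nuM := isMeasure.Build _ _ _ nu0 nu0_0 nu0_ge0 nu0_sa.
pose nu1 : {measure set (borel X) -> \bar R} := HB.pack nu0 nuM.
have nu_fin : fin_num_fun nu1.
  move=> A mA; rewrite fin_num_abs gee0_abs//.
  apply: (@le_lt_trans _ _ (mu setT)); last by rewrite muT ltry.
  change (mu (stone_limit @^-1` A) <= mu setT)%E.
  apply: le_measure; rewrite ?inE//.
  by rewrite -[X in measurable X]setTI; exact: mq.
pose nuF := Measure_isFinite.Build _ _ _ nu1 nu_fin.
pose nu : {finite_measure set (borel X) -> \bar R} := HB.pack nu0 nuM nuF.
exists nu => f fc.
have [M0 fM0] := compact_continuous_bounded Xc fc.
pose M := Num.max M0 0.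
have M_ge0 : 0 <= M by rewrite le_max lexx orbT.
have fM x : `|f x| <= M by rewrite le_max fM0.
pose O := g_sigma_algebraType (@measurable _ (stone X)).
pose q : O -> borel X := stone_limit.
have int_bounded (h : O -> R) : measurable_fun setT h -> bounded_real h ->
    mu.-integrable setT (EFin \o h).
  move=> mh [N hN]; apply: measurable_bounded_integrable => //.
    by rewrite muT ltry.
  exists N; split; first exact: num_real.
  by move=> t Nt x _; apply: le_trans (hN x) (ltW Nt).
have mfq : measurable_fun setT (f \o q).
  by apply: measurableT_comp mq; exact: continuous_borel_measurable.
have int_fq : mu.-integrable setT (EFin \o (f \o q)).
  by apply: int_bounded => //; exists M => w; exact: fM.
have IE : Rintegral nu setT f = Rintegral mu setT (f \o q).
  rewrite /Rintegral; congr fine.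
  apply: (@integral_pushforward _ _ _ _ _ _ mq mu setT (EFin \o f)) => //.
  by apply/measurable_EFinP; exact: continuous_borel_measurable.
rewrite IE; set I := Rintegral mu setT _.
have mT_ge0 := m_ge0 setT.
have IcstE (c : R) : Rintegral mu setT (fun=> c) = c * m setT.
  by rewrite Rintegral_cst// muT.
have int_cst (c : R) : mu.-integrable setT (EFin \o (fun=> c)).
  by apply: int_bounded => //; exists `|c|.
have close e : 0 < e -> `|L f - I| <= e * m setT.
  move=> e0.
  pose A j := [set x | j.+1%:R * e <= f x + M].
  pose N := Num.truncn (2 * M / e).
  have NM : 2 * M <= N.+1%:R * e.
    by rewrite -ler_pdivrMr// ltW// truncnS_gt.
  pose gX n : X -> R := \sum_(j < n) e *: \1_(A j).
  pose gO n : O -> R := \sum_(j < n) e *: \1_(stone_clopen (A j)).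
  have gXE n : bounded_real (gX n) /\ L (gX n) = \sum_(j < n) e * m (A j).
    rewrite /gX; elim: n => [|n [b IH]].
      rewrite !big_ord0; split; first by exists 0 => x; rewrite -[leRHS](normr0 R).
      by rewrite -(scale0r (\1_setT : X -> R)) LZ// mul0r.
    rewrite !big_ord_recr /=; split; first by apply: bD => //; exact: bZ.
    by rewrite LD ?LZ ?IH//; exact: bZ.
  have mC j : measurable (stone_clopen (A j) : set O).
    by apply: sub_sigma_algebra; exists (A j).
  have int1 j : mu.-integrable setT (EFin \o (e *: \1_(stone_clopen (A j)) : O -> R)).
    apply: int_bounded.
      apply: measurable_funM; first exact: measurable_cst.
      exact: measurable_indic.
    exists e => w; change (`|e * \1_(stone_clopen (A j)) w| <= e).
    rewrite indicE; case: (w \in _).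
      by rewrite /= mulr1 gtr0_norm.
    by rewrite /= mulr0 normr0 ltW.
  have gOE n : mu.-integrable setT (EFin \o gO n) /\
      Rintegral mu setT (gO n) = \sum_(j < n) e * m (A j).
    rewrite /gO; elim: n => [|n [b IH]].
      rewrite !big_ord0; split; first exact: (int_cst 0).
      by have := IcstE 0; rewrite mul0r.
    rewrite !big_ord_recr /=; split.
      by apply: (integrableD _ b (int1 n)).
    rewrite (RintegralD _ b (int1 n))// IH; congr (_ + _).
    rewrite RintegralZl//; last first.
      apply: int_bounded; first exact: measurable_indic.
      exists 1 => w; rewrite indicE; case: (w \in _) => /=.
        by rewrite normr1.
      by rewrite normr0.
    by rewrite /Rintegral integral_indic// setIT muE.
  have [bX] := gXE N.+1; have [bO] := gOE N.+1.
  set S := \sum_(j < N.+1) e * m (A j) => IO LX.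
  have bf : bounded_real f by exists M.
  have gX_steps x : gX N.+1 x <= f x + M <= gX N.+1 x + e.
    rewrite (_ : gX _ x = \sum_(j < N.+1) (if j.+1%:R * e <= f x + M then e else 0)).
      have /ler_normlP[fMx Mfx] := fM x.
      by apply: sum_steps_floor => //; lra.
    rewrite /gX fct_sumE; apply: eq_bigr => j _.
    change (e * \1_(A j) x = if j.+1%:R * e <= f x + M then e else 0).
    rewrite indicE; case: ifPn => [/mem_set|] Ax.
      by rewrite (_ : x \in A j) ?mulr1.
    by rewrite memNset ?mulr0//; exact/negP.
  have gO_steps w : gO N.+1 w <= f (q w) + M <= gO N.+1 w + e.
    by have := stone_limit_step w fc e0 fM NM; rewrite /gO fct_sumE.
  have cstE c x : (c *: \1_setT : X -> R) x = c.
    change (c * \1_setT x = c).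
    by rewrite indicE in_setT mulr1.
  have LX1 : S <= L f + M * m setT.
    rewrite -LX -LZ// -LD//; last exact: bZ.
    apply: L_le => //; first by apply: bD => //; exact: bZ.
    by move=> x; rewrite fctE cstE; have /andP[] := gX_steps x.
  have LX2 : L f + M * m setT <= S + e * m setT.
    rewrite -LX -!LZ// -!LD//; [|exact: bZ..].
    apply: L_le => //; [by apply: bD => //; exact: bZ..|].
    move=> x.
    change (f x + (M *: \1_setT : X -> R) x <=
      gX N.+1 x + (e *: \1_setT : X -> R) x).
    by rewrite !cstE; have /andP[] := gX_steps x.
  have IO1 : S <= I + M * m setT.
    rewrite -IO -IcstE /I -RintegralD//.
    apply: le_Rintegral => //; first exact: (integrableD _ int_fq (int_cst M)).
    by move=> w _; have /andP[] := gO_steps w.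
  have IO2 : I + M * m setT <= S + e * m setT.
    rewrite -IO -!IcstE /I -!RintegralD//.
    apply: le_Rintegral => //; first exact: (integrableD _ int_fq (int_cst M)).
      exact: (integrableD _ bO (int_cst e)).
    by move=> w _; have /andP[] := gO_steps w.
  by apply/ler_normlP; split; lra.
apply/eqP; rewrite -subr_eq0 -normr_le0 leNgt; apply/negP => d_gt0.
(* The added 1 avoids dividing by a vanishing total mass. *)
have c_gt0 : 0 < m setT + 1 by lra.
have := close _ (divr_gt0 d_gt0 c_gt0).
rewrite mulrAC ler_pdivlMr// ler_pM2l//; lra.
Qed.

End riesz.

(** * The flat torus *)

Section period.
Context (R : realType).

Lemma periodic2pi_int (f : R -> R) (t k : R) : periodic f (pi *+ 2) ->
  k \is a Num.int -> f (pi *+ 2 * (t + k)) = f (pi *+ 2 * t).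
Proof.
move=> fper /intrP[[n|n] ->]; rewrite mulrDr.
  by rewrite -pmulrn mulr_natr periodicn.
by rewrite NegzE mulrNz mulrN -pmulrn mulr_natr -(periodicn fper n.+1) subrK.
Qed.

Lemma cos2pi_eq1 (t : R) : cos (pi *+ 2 * t) = 1 -> t \is a Num.int.
Proof.
have pi0 : 0 < pi :> R by exact: pi_gt0.
have half (r : R) : 0 <= r -> r <= 1/2 -> cos (pi *+ 2 * r) = 1 -> r = 0.
  move=> r0 r1 cr; have : pi *+ 2 * r = 0.
    apply: cos_inj; rewrite ?in_itv/= ?cos0 ?lexx ?(ltW pi0)//.
    apply/andP; split; first by rewrite mulr_ge0// mulrn_wge0// ltW.
    by rewrite mulr2n; nra.
  by move/eqP; rewrite mulf_eq0 mulrn_eq0/= gt_eqF// => /eqP.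
(* Reduce to the fractional part [r], and then to [r <= 1/2] by parity, where
   the cosine is injective. *)
pose r := t - (Num.floor t)%:~R.
have tE : t = r + (Num.floor t)%:~R by rewrite /r subrK.
have r0 : 0 <= r by rewrite subr_ge0 floor_le_tmp.
have r1 : r < 1 by rewrite ltrBlDl -intrD1 floorD1_gt.
rewrite {1}tE (periodic2pi_int _ (@cosD2pi R)); last exact: intr_int.
have [r12|r12] := leP r (1/2).
  by move=> /(half _ r0 r12) r_eq0; rewrite tE r_eq0 add0r intr_int.
rewrite -cosN -mulrN -(periodic2pi_int _ (@cosD2pi R) (k := 1))//.
by rewrite addrC => /half h; have := h _ _; lra.
Qed.

End period.

Section torus_topology.
Context (R : realType) (n : nat).
Local Notation T := (torus R n).
Implicit Types x y : T.

Lemma repr_pi_int (a : 'rV[R]_n) j :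
  repr (\pi_T a) ord0 j - a ord0 j \is a Num.int.
Proof.
have : torus_rel R n (repr (\pi_T a)) a by apply/eqquotP; exact: reprK.
by move=> /forallP.
Qed.

Lemma torus_eq x y :
  (forall j, repr x ord0 j - repr y ord0 j \is a Num.int) -> x = y.
Proof.
by move=> xy; rewrite -(reprK x) -(reprK y); apply/eqquotP/forallP.
Qed.

Lemma torus_lift_continuous (Z : topologicalType) (f : T -> Z) :
  continuous (fun a => f (\pi_T a)) -> continuous f.
Proof. by move=> fc; apply/(@quotient_continuous _ T). Qed.

Lemma pi_torus_continuous : continuous (\pi_T : 'rV[R]_n -> T).
Proof. exact: (@pi_continuous _ T). Qed.

Lemma torus_compact : compact [set: T].
Proof.
pose cube := [set v : 'rV[R]_n | forall i, (`[0, 1]%classic : set R) (v ord0 i)].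
have -> : [set: T] = \pi_T @` cube.
  apply/seteqP; split => // x _.
  exists (\row_j (repr x ord0 j - (Num.floor (repr x ord0 j))%:~R)) => /=.
    move=> j; rewrite mxE /= in_itv /= subr_ge0 floor_le_tmp/= lerBlDl.
    by rewrite -intrD1 ltW// floorD1_gt.
  apply: torus_eq => j; set a := \row_j _.
  have := rpredB (repr_pi_int a j) (intr_int R (Num.floor (repr x ord0 j))).
  by rewrite {2}/a mxE opprB addrA addrAC addrK.
apply: continuous_compact.
  by apply: continuous_subspaceT; exact: pi_torus_continuous.
by apply: (@rV_compact R n (fun=> `[0, 1]%classic)) => i; exact: segment_compact.
Qed.

Lemma gradient_periodic (psi : T -> R) (a b : 'rV[R]_n) : \pi_T a = \pi_T b ->
  gradient (periodic_lift psi) a = gradient (periodic_lift psi) b.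
Proof.
move=> ab; apply/rowP => j; rewrite !mxE /derive.
pose quot c h : R :=
  h^-1 *: ((periodic_lift psi \o shift c) (h *: delta_mx ord0 j) -
           periodic_lift psi c).
suff abE : quot a = quot b by rewrite -/(quot a) -/(quot b) abE.
apply/funext => h; rewrite /quot /= /periodic_lift ab; congr (_ *: (psi _ - _)).
apply/eqquotP/forallP => i; rewrite !mxE opprD addrACA subrr add0r.
have /eqquotP/forallP/(_ i) := ab.
by [].
Qed.

Lemma Dtorus_lift (psi : T -> R) (a : 'rV[R]_n) :
  Dtorus psi (\pi_T a) = gradient (periodic_lift psi) a.
Proof. by apply: gradient_periodic; rewrite reprK. Qed.

Lemma Dtorus_continuous (psi : T -> R) : C1 psi -> continuous (Dtorus psi).
Proof.
move=> [_ gc]; apply: torus_lift_continuous.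
rewrite (_ : (fun _ => _) = gradient (periodic_lift psi))//.
by apply/funext => a; exact: Dtorus_lift.
Qed.

Lemma C1_continuous (psi : T -> R) : C1 psi -> continuous psi.
Proof.
move=> [dc _]; apply: torus_lift_continuous => a.
exact: (differentiable_continuous (dc a)).
Qed.

Lemma C1D (psi chi : T -> R) : C1 psi -> C1 chi ->
  C1 (psi + chi) /\ Dtorus (psi + chi) = Dtorus psi + Dtorus chi.
Proof.
move=> [dp cp] [dc cc].
have gE : gradient (periodic_lift (psi + chi)) =
    gradient (periodic_lift psi) + gradient (periodic_lift chi).
  apply/funext => a; apply/rowP => j; rewrite !mxE.
  by rewrite -deriveD//; exact: diff_derivable.
split; last by apply/funext => x; rewrite /Dtorus gE.
split; first by move=> a; exact: differentiableD (dp a) (dc a).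
by rewrite gE => a; exact: (cvgD (cp a) (cc a)).
Qed.

Lemma C1Z (c : R) (psi : T -> R) : C1 psi ->
  C1 (c *: psi) /\ Dtorus (c *: psi) = c *: Dtorus psi.
Proof.
move=> [dp cp].
have gE : gradient (periodic_lift (c *: psi)) = c *: gradient (periodic_lift psi).
  apply/funext => a; apply/rowP => j; rewrite !mxE.
  exact: (deriveZ c (diff_derivable (v := delta_mx ord0 j) (dp a))).
split; last by apply/funext => x; rewrite /Dtorus gE.
split; first by move=> a; exact: differentiableZ (dp a).
by rewrite gE => a; exact: (cvgZl_tmp (k := c) (cp a)).
Qed.

End torus_topology.

Lemma gradient_separated_sum (R : realType) (n : nat) (phi dphi : 'I_n -> R -> R) :
  (forall j (t : R), is_derive t 1 (phi j) (dphi j t)) ->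
  forall a : 'rV[R]_n,
    differentiable (fun b : 'rV[R]_n => \sum_j phi j (b ord0 j)) a /\
    gradient (fun b : 'rV[R]_n => \sum_j phi j (b ord0 j)) a = \row_j dphi j (a ord0 j).
Proof.
move=> dphiP a.
pose c j := fun b : 'rV[R]_n => b ord0 j : R.
have cd j b : differentiable (c j) b by exact: differentiable_coord.
have cD j b v : 'd (c j) b v = v ord0 j.
  rewrite -deriveE// /derive.
  have -> : (fun h : R => h^-1 *: ((c j \o shift b) (h *: v) - c j b)) =
      (fun h : R => h^-1 * h * v ord0 j).
    by apply/funext => h; rewrite /c /= !mxE addrK scalerA.
  apply: cvg_lim => //.
  apply: cvg_near_cst; near=> h.
  rewrite mulVf ?mul1r//; near: h; exact: nbhs_dnbhs_neq.
have pd j t : differentiable (phi j) t.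
  by apply/derivable1_diffP; have [] := dphiP j t.
have pc j : differentiable (phi j \o c j) a by exact: differentiable_comp.
have -> : (fun b : 'rV[R]_n => \sum_j phi j (b ord0 j)) = \sum_j (phi j \o c j).
  by apply/funext => b; rewrite fct_sumE.
split; first exact: differentiable_sum.
apply/rowP => k; rewrite !mxE derive_sum; last by move=> i; exact: diff_derivable.
rewrite (bigD1 k)//= big1 ?addr0 => [|j jk].
  rewrite deriveE// diff_comp//= cD diff1E//= mxE !eqxx scale1r derive1E.
  by have [] := dphiP k (c k a).
rewrite deriveE// diff_comp//= cD diff1E//= mxE (negbTE jk) andbF.
by rewrite scale0r.
Unshelve. all: by end_near. Qed.

Lemma cvg_rV (R : realType) (n : nat) (I : Type) (F : set_system I) {FF : Filter F}
    (f : I -> 'rV[R]_n) (l : 'rV[R]_n) :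
  (forall j, f x ord0 j @[x --> F] --> l ord0 j) -> f @ F --> l.
Proof.
move=> fl; apply/cvg_ballP => e e0.
have : \forall x \near F, forall j, ball (l ord0 j) e (f x ord0 j).
  by apply: filter_forall => j; move/cvg_ballP : (fl j); exact.
by apply: filterS => x h; split => // i j; rewrite !ord1.
Qed.

Section sep.
Context (R : realType) (n : nat).
Local Notation T := (torus R n).
Implicit Types x y : T.

(** A smooth periodic substitute for the squared distance; its vanishing set is
    the diagonal and its two partial gradients are opposite to each other. *)
Definition sep x y : R :=
  \sum_j (1 - cos (pi *+ 2 * (repr x ord0 j - repr y ord0 j))).

Lemma sep_lift y (a : 'rV[R]_n) :
  sep (\pi_T a) y = \sum_j (1 - cos (pi *+ 2 * (a ord0 j - repr y ord0 j))).
Proof.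
apply: eq_bigr => j _; congr (1 - _).
rewrite -(periodic2pi_int (a ord0 j - repr y ord0 j) (@cosD2pi R) (repr_pi_int a j)).
by congr (cos (_ * _)); ring.
Qed.

Lemma sepC x y : sep x y = sep y x.
Proof.
by apply: eq_bigr => j _; rewrite -[repr x _ _ - _]opprB mulrN cosN.
Qed.

Lemma sepxx x : sep x x = 0.
Proof. by rewrite /sep big1// => j _; rewrite subrr mulr0 cos0 subrr. Qed.

Lemma sep_ge0 x y : 0 <= sep x y.
Proof. by apply: sumr_ge0 => j _; rewrite subr_ge0 cos_le1. Qed.

Lemma sep_gt0 x y : x <> y -> 0 < sep x y.
Proof.
move=> xy; rewrite lt_neqAle sep_ge0 andbT eq_sym; apply/eqP => /eqP.
rewrite psumr_eq0; last by move=> j _; rewrite subr_ge0 cos_le1.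
move=> /allP h; apply: xy; apply: torus_eq => j; apply: cos2pi_eq1.
by have := h j (mem_index_enum _) => /=; rewrite subr_eq0 => /eqP.
Qed.

Lemma torus_periodic_continuous (f : R -> R) j : continuous f -> periodic f (pi *+ 2) ->
  continuous (fun x => f (pi *+ 2 * repr x ord0 j)).
Proof.
move=> fc fp; apply: torus_lift_continuous.
rewrite (_ : (fun _ => _) = (fun a : 'rV[R]_n => f (pi *+ 2 * a ord0 j))).
  move=> a; apply: continuous_comp; last exact: fc.
  exact: (cvgM (cvg_cst _) (@coord_continuous R 1 n ord0 j a)).
apply/funext => a; rewrite -(periodic2pi_int (a ord0 j) fp (repr_pi_int a j)).
by rewrite addrCA subrr addr0.
Qed.

(** The addition formula reduces this to functions of one torus variable, where
    the quotient topology is easy to use. *)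
Lemma sep_continuous : continuous (fun p : T * T => sep p.1 p.2).
Proof.
have := @continuous_big R 'I_n +%R 0 xpredT (@add_continuous R) (T * T)%type
  (index_enum 'I_n)
  (fun j p => 1 - cos (pi *+ 2 * (repr p.1 ord0 j - repr p.2 ord0 j))).
apply => j _ p.
apply: cvgB; first exact: cvg_cst.
under eq_fun do rewrite mulrBr cosB.
rewrite mulrBr cosB.
have c1 (f : R -> R) : continuous f -> periodic f (pi *+ 2) ->
    (fun q : T * T => f (pi *+ 2 * repr q.1 ord0 j)) @ p --> f (pi *+ 2 * repr p.1 ord0 j).
  move=> fc fp.
  apply: (@continuous_comp (T * T)%type T R fst
    (fun x => f (pi *+ 2 * repr x ord0 j)) p); first exact: cvg_fst.
  exact: torus_periodic_continuous.
have c2 (f : R -> R) : continuous f -> periodic f (pi *+ 2) ->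
    (fun q : T * T => f (pi *+ 2 * repr q.2 ord0 j)) @ p --> f (pi *+ 2 * repr p.2 ord0 j).
  move=> fc fp.
  apply: (@continuous_comp (T * T)%type T R snd
    (fun x => f (pi *+ 2 * repr x ord0 j)) p); first exact: cvg_snd.
  exact: torus_periodic_continuous.
by apply: cvgD; apply: cvgM; (apply: c1 || apply: c2);
  (exact: continuous_cos || exact: continuous_sin || exact: cosD2pi || exact: sinD2pi).
Qed.

Lemma C1_sep y : C1 (sep^~ y) /\ Dtorus (sep^~ y) =
  fun x => \row_j (pi *+ 2 * sin (pi *+ 2 * (repr x ord0 j - repr y ord0 j))).
Proof.
pose phi j (t : R) := 1 - cos (pi *+ 2 * (t - repr y ord0 j)).
pose dphi j (t : R) := pi *+ 2 * sin (pi *+ 2 * (t - repr y ord0 j)).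
have phiP j (t : R) : is_derive t 1 (phi j) (dphi j t).
  pose g : R -> R := (pi *+ 2 : R) \*: ((id : R -> R) - cst (repr y ord0 j)).
  have gd : is_derive t 1 g (pi *+ 2).
    by apply: is_derive_eq; rewrite subr0 -[RHS]mulr1.
  have -> : phi j = (cst 1 : R -> R) - (cos \o g) by [].
  have cd := is_derive1_comp (is_derive_cos (g t)) gd.
  apply: (is_derive_eq (is_deriveB (is_derive_cst (1 : R) t 1) cd)).
  by rewrite sub0r /dphi mulNr opprK mulrC.
have liftE : periodic_lift (sep^~ y) = fun a => \sum_j phi j (a ord0 j).
  by apply/funext => a; exact: sep_lift.
have gE : gradient (periodic_lift (sep^~ y)) = fun a => \row_j dphi j (a ord0 j).
  by apply/funext => a; rewrite liftE; have [] := gradient_separated_sum phiP a.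
split; last by apply/funext => x; rewrite /Dtorus gE.
split; first by move=> a; rewrite liftE; have [] := gradient_separated_sum phiP a.
rewrite gE => a; apply: (@cvg_rV _ _ _ (nbhs a) _) => j; rewrite mxE.
rewrite (_ : (fun b : 'rV[R]_n => _) = dphi j \o (fun b : 'rV[R]_n => b ord0 j));
  last first.
  by apply/funext => b; rewrite mxE.
apply: (@continuous_comp _ _ _ (fun b : 'rV[R]_n => b ord0 j) (dphi j) a).
  exact: (@coord_continuous R 1 n ord0 j a).
rewrite /dphi; apply: cvgM; first exact: cvg_cst.
apply: (@continuous_comp R R R (fun t => pi *+ 2 * (t - repr y ord0 j)) sin).
  exact: (cvgM (cvg_cst _) (cvgB cvg_id (cvg_cst _))).
exact: continuous_sin.
Qed.

End sep.

Arguments sep {R n} x y.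

(** * Doubling of variables *)

Section fuzzy.
Context (R : realType) (n : nat).
Local Notation T := (torus R n).

(** Away from the diagonal the penalty [alpha * sep] wins for large [alpha]; on
    the diagonal but away from [x0] the term [sep q.1 x0] makes the value
    strictly smaller than at [(x0, x0)].  By compactness one [alpha] serves the
    whole complement of [U]. *)
Lemma penalized_maximizers_localize (h : T * T -> R) (x0 : T) (U : set (T * T)) :
  continuous h -> (forall x, h (x, x) <= h (x0, x0)) -> nbhs (x0, x0) U ->
  exists alpha p, [/\ 0 <= alpha, U p &
    forall q, h q - alpha * sep q.1 q.2 - sep q.1 x0 <=
              h p - alpha * sep p.1 p.2 - sep p.1 x0].
Proof.
move=> hc h_diag Ux0.
pose Phi (alpha : R) (q : T * T) := h q - alpha * sep q.1 q.2 - sep q.1 x0.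
have sep0c : continuous (fun q : T * T => sep q.1 x0).
  move=> q; apply: (@continuous_comp (T * T)%type T R fst (sep^~ x0) q).
    exact: cvg_fst.
  exact: (C1_continuous (C1_sep x0).1).
have Phic alpha : continuous (Phi alpha).
  move=> q; apply: cvgB; last exact: sep0c.
  apply: cvgB; first exact: hc.
  by apply: cvgM; [exact: cvg_cst|exact: sep_continuous].
pose base (q : T * T) := h q - sep q.1 x0.
have basec : continuous base by move=> q; apply: cvgB; [exact: hc|exact: sep0c].
have Tc : compact [set: T * T].
  by rewrite -setXTT; apply: compact_setX; exact: torus_compact.
have : \forall alpha \near +oo, [set: T * T] `<=`
    [set q | U q \/ Phi alpha q < h (x0, x0)].
  move/compact_near_coveringP : Tc; apply => -[x y] _.
  have [xy|/sep_gt0 sxy] := pselect (x = y).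
    have [xx0|xx0] := pselect (x = x0).
      exists (U, setT); first by split; [rewrite /= -xy xx0|exact: filterT].
      by move=> [q alpha] [/= Uq _]; left.
    have bx : base (x, y) < h (x0, x0).
      rewrite /base -xy /=; have := h_diag x; have := sep_gt0 xx0; lra.
    exists ([set q | base q < h (x0, x0)], [set alpha | 0 <= alpha]).
      split => /=; last exact: nbhs_pinfty_ge.
      exact: (cvgr_lt _ (basec (x, y))).
    move=> [q alpha] [/= bq a0]; right; rewrite /Phi.
    have := mulr_ge0 a0 (sep_ge0 q.1 q.2).
    by move: bq; rewrite /base; lra.
  pose s := sep x y / 2.
  have s0 : 0 < s by rewrite divr_gt0.
  pose A := Num.max 0 ((base (x, y) + 1 - h (x0, x0)) / s).
  exists ([set q | base q < base (x, y) + 1 /\ s < sep q.1 q.2],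
          [set alpha | A <= alpha]).
    split; last exact: nbhs_pinfty_ge (num_real _).
    apply: filterI; first by apply: (cvgr_lt _ (basec (x, y))); lra.
    by apply: (cvgr_gt _ (@sep_continuous R n (x, y))); rewrite /= /s; lra.
  move=> [q alpha] [/= [bq sq]]; rewrite ge_max => /andP[a0].
  rewrite ler_pdivrMr// => aA; right; rewrite /Phi.
  have := ler_wpM2l a0 (ltW sq).
  by move: bq aA; rewrite /base; lra.
move=> near_alpha.
have [alpha [a0 locU]] : exists alpha, 0 <= alpha /\ [set: T * T] `<=`
    [set q | U q \/ Phi alpha q < h (x0, x0)].
  have /filter_ex[alpha [? ?]] : \forall alpha \near (+oo : set_system R),
      0 <= alpha /\ [set: T * T] `<=` [set q | U q \/ Phi alpha q < h (x0, x0)].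
    by apply: filterI => //; exact: nbhs_pinfty_ge.
  by exists alpha.
have [] := @compact_EVT_max _ R (Phi alpha) [set: T * T] _ Tc _.
- by exists (x0, x0).
- exact: continuous_subspaceT.
move=> p _ pmax; exists alpha, p; split => //.
  have [//|] := locU p I.
  have := pmax (x0, x0) (in_setT _); rewrite {1}/Phi /= !sepxx mulr0 !subr0.
  by move=> h1 /(le_lt_trans h1); rewrite ltxx.
by move=> q; apply: pmax; rewrite in_setT.
Qed.

(** Freezing one variable at a maximizer of the penalized function gives the two
    test functions.  The gradients of the penalty cancel in the sum, so what
    remains is [Dtorus psi x] plus the gradient of [sep^~ x0] at [x], which tends
    to [Dtorus psi x0] as [x] tends to [x0]. *)
Lemma fuzzy_sum_rule (a b psi : T -> R) (x0 : T) (N : set T) (d : R) :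
  continuous a -> continuous b -> C1 psi ->
  (forall y, a y + b y - psi y <= a x0 + b x0 - psi x0) ->
  nbhs x0 N -> 0 < d ->
  exists x y pa pb, [/\ N x, N y, C1 pa & C1 pb] /\
    [/\ forall w, a w - pa w <= a x - pa x,
        forall w, b w - pb w <= b y - pb y
      & `|Dtorus pa x + Dtorus pb y - Dtorus psi x0| <= d].
Proof.
move=> ac bc psi1 x0max Nx0 d0.
have [s1 sE] := C1_sep x0.
pose g x := Dtorus psi x + Dtorus (sep^~ x0) x.
have g0 : g x0 = Dtorus psi x0.
  rewrite /g sE (_ : \row_j _ = 0) ?addr0//.
  by apply/rowP => j; rewrite !mxE subrr mulr0 sin0 mulr0.
have Ng : \forall x \near x0, `|Dtorus psi x0 - g x| < d.
  have gc : g x @[x --> x0] --> g x0.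
    exact: (cvgD (Dtorus_continuous psi1 (x := x0)) (Dtorus_continuous s1 (x := x0))).
  by rewrite -g0; move/cvgrPdist_lt : gc => /(_ d d0).
pose N' := N `&` [set x | `|Dtorus psi x0 - g x| < d].
have N'x0 : nbhs x0 N' by exact: filterI.
pose h (q : T * T) := a q.1 + b q.2 - psi q.1.
have hc : continuous h.
  have c1 (f : T -> R) : continuous f -> continuous (fun q : T * T => f q.1).
    by move=> fc q; apply: (@continuous_comp (T * T)%type T R fst f q);
      [exact: cvg_fst|exact: fc].
  have c2 (f : T -> R) : continuous f -> continuous (fun q : T * T => f q.2).
    by move=> fc q; apply: (@continuous_comp (T * T)%type T R snd f q);
      [exact: cvg_snd|exact: fc].
  move=> q; apply: cvgB; last exact: (c1 _ (C1_continuous psi1)).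
  by apply: cvgD; [exact: c1|exact: c2].
have [|alpha [[x y] [a0 [/= [Nx gx] [Ny _]] pmax]]] :=
  @penalized_maximizers_localize h x0 (N' `*` N') hc x0max.
  by exists (N', N').
have [sy1 syE] := C1_sep y; have [sx1 sxE] := C1_sep x.
have [asy1 asyE] := C1Z alpha sy1; have [asx1 asxE] := C1Z alpha sx1.
have [p1 p1E] := C1D psi1 asy1; have [p2 p2E] := C1D p1 s1.
exists x, y, (psi + alpha *: sep^~ y + sep^~ x0), (alpha *: sep^~ x).
split => //; split.
- move=> w; have := pmax (w, y); rewrite /h /=.
  change (a w + b y - psi w - alpha * sep w y - sep w x0 <=
     a x + b y - psi x - alpha * sep x y - sep x x0 ->
    a w - (psi w + alpha * sep w y + sep w x0) <=
    a x - (psi x + alpha * sep x y + sep x x0)).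
  by lra.
- move=> w; have := pmax (x, w); rewrite /h /= (sepC x w) (sepC x y).
  change (a x + b w - psi x - alpha * sep w x - sep x x0 <=
     a x + b y - psi x - alpha * sep y x - sep x x0 ->
    b w - alpha * sep w x <= b y - alpha * sep y x).
  by lra.
rewrite p2E p1E asyE asxE !fctE.
suff DE : Dtorus (sep^~ x) y = - Dtorus (sep^~ y) x.
  rewrite DE scalerN [X in X - Dtorus psi x0](_ : _ = g x).
    by rewrite distrC ltW.
  by rewrite /g (addrAC (Dtorus psi x)) addrK.
rewrite syE sxE; apply/rowP => j; rewrite !mxE.
by rewrite -[repr y _ _ - _]opprB mulrN sinN mulrN.
Qed.

End fuzzy.

(** * Hamiltonians *)

Lemma coord_le_norm (R : realType) (n : nat) (p : 'rV[R]_n) j :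
  `|p ord0 j| <= `|p|.
Proof.
rewrite {2}/Num.Def.normr /= mx_normrE.
exact: (@le_bigmax _ _ _ 0 (fun ij : 'I_1 * 'I_n => `|p ij.1 ij.2|) (ord0, j)).
Qed.

Lemma norm_le_coord (R : realType) (n : nat) (p : 'rV[R]_n) (c : R) :
  0 <= c -> (forall j, `|p ord0 j| <= c) -> `|p| <= c.
Proof.
move=> c0 pc; rewrite {1}/Num.Def.normr /= mx_normrE.
by apply: bigmax_le => // -[i j] _ /=; rewrite ord1.
Qed.

Lemma dotpDr (R : realType) (n : nat) (a p q : 'rV[R]_n) :
  dotp a (p + q) = dotp a p + dotp a q.
Proof. by rewrite /dotp -big_split; apply: eq_bigr => j _; rewrite mxE mulrDr. Qed.

Lemma dotpBl (R : realType) (n : nat) (a b p : 'rV[R]_n) :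
  dotp (a - b) p = dotp a p - dotp b p.
Proof. by rewrite /dotp -sumrB; apply: eq_bigr => j _; rewrite !mxE mulrBl. Qed.

Lemma dotpZr (R : realType) (n : nat) (a p : 'rV[R]_n) c :
  dotp a (c *: p) = c * dotp a p.
Proof. by rewrite /dotp big_distrr; apply: eq_bigr => j _; rewrite mxE mulrCA. Qed.

Lemma norm_dotp_le (R : realType) (n : nat) (a p : 'rV[R]_n) :
  `|dotp a p| <= n%:R * `|a| * `|p|.
Proof.
apply: (le_trans (ler_norm_sum _ _ _)).
apply: (@le_trans _ _ (\sum_(j < n) `|a| * `|p|)).
  by apply: ler_sum => j _; rewrite normrM ler_pM ?coord_le_norm.
by rewrite sumr_const card_ord -[leLHS]mulr_natl mulrA.
Qed.

Lemma norm_le_enorm (R : realType) (n : nat) (p : 'rV[R]_n) : `|p| <= enorm p.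
Proof.
apply: norm_le_coord => [|j]; first exact: sqrtr_ge0.
rewrite -sqrtr_sqr ler_wsqrtr// /dotp (bigD1 j)//= expr2 lerDl.
by apply: sumr_ge0 => i _; rewrite -expr2 sqr_ge0.
Qed.

(** Tube lemma: the modulus of continuity at [x0] is uniform along a compact
    fiber. *)
Lemma compact_fiber_continuous (R : realType) (T Y : topologicalType)
    (W : normedModType R) (f : T * Y -> W) (x0 : T) (e : R) :
  compact [set: Y] -> continuous f -> 0 < e ->
  \forall x \near x0, forall y, `|f (x, y) - f (x0, y)| <= e.
Proof.
move=> Yc fc e0.
have /(_ T (nbhs x0) (fun x y => `|f (x, y) - f (x0, y)| <= e)) :=
  (compact_near_coveringP _).1 Yc.
suff h (y : Y) : \forall y' \near y & x \near x0, `|f (x, y') - f (x0, y')| <= e.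
  move=> /(_ _ (fun y _ => h y)); apply: filterS => x hx y; exact: hx.
have e20 : 0 < e / 2 by rewrite divr_gt0.
have [[A B] /= [nA nB] AB] : \forall q \near (x0, y), `|f (x0, y) - f q| < e / 2.
  by apply: cvgr_dist_lt (fc (x0, y)) _ e20.
exists (B, A) => //= -[y' x] /= [By' Ax].
have h1 := AB (x, y') (conj Ax By').
have h2 := AB (x0, y') (conj (nbhs_singleton nA) By').
rewrite -(subrKA (f (x0, y))) (le_trans (ler_normD _ _))//.
by rewrite (splitr e) lerD// ltW// distrC.
Qed.

Section hamiltonian.
Context (R : realType) (m n : nat) (Xi : pmetricType R).
Context (g : 'I_m -> torus R n * Xi -> 'rV[R]_n).
Context (Xi_compact : compact [set: Xi]).
Context (g_cont : forall i, continuous (g i)).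
Local Notation T := (torus R n).
Local Notation cost := ('I_m -> T * Xi -> R).
Implicit Types (phi : cost) (x : T) (p q : 'rV[R]_n).

Definition continuous_cost phi := forall i, continuous (phi i).

Lemma cost_compact : compact [set: T * Xi].
Proof. by rewrite -setXTT; apply: compact_setX => //; exact: torus_compact. Qed.

Lemma cost_bounded phi : continuous_cost phi ->
  exists2 M, 0 <= M & forall i y, `|phi i y| <= M.
Proof.
move=> phic.
have /choice[M MP] : forall i, exists M, forall y, `|phi i y| <= M.
  by move=> i; exact: (compact_continuous_bounded cost_compact (phic i)).
exists (\sum_i `|M i|) => [|i y]; first exact: sumr_ge0.
rewrite (bigD1 i)//= (le_trans (MP i y))// (le_trans (ler_norm _))// lerDl.
exact: sumr_ge0.
Qed.

Lemma drift_bounded : exists2 G, 0 <= G & forall i y, `|g i y| <= G.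
Proof.
have [|G G0 GP] := @cost_bounded (fun i y => `|g i y|).
  by move=> i y; apply: cvg_norm; exact: g_cont.
by exists G => // i y; rewrite -normr_id.
Qed.

Lemma ham_ubound phi i x p : continuous_cost phi ->
  has_ubound (range (fun xi : Xi => - dotp (g i (x, xi)) p - phi i (x, xi))).
Proof.
move=> phic; have [M M0 MP] := cost_bounded phic; have [G G0 GP] := drift_bounded.
exists (n%:R * G * `|p| + M) => _ [xi _ <-].
rewrite (le_trans (ler_norm _))// (le_trans (ler_normB _ _))// lerD// normrN.
by rewrite (le_trans (norm_dotp_le _ _))// ler_wpM2r// ler_wpM2l.
Qed.

Lemma ham_ge phi i x p xi : continuous_cost phi ->
  - dotp (g i (x, xi)) p - phi i (x, xi) <= hamiltonian g phi i x p.
Proof. by move=> phic; apply: ub_le_sup; [exact: ham_ubound|exists xi]. Qed.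

Lemma ham_le phi i x p c :
  (forall xi, - dotp (g i (x, xi)) p - phi i (x, xi) <= c) ->
  hamiltonian g phi i x p <= c.
Proof.
move=> h; apply: ge_sup; last by move=> _ [xi _ <-]; exact: h.
by exists (- dotp (g i (x, point)) p - phi i (x, point)), point.
Qed.

Lemma ham_mono phi phi' c i x p : continuous_cost phi' ->
  (forall y, phi' i y <= phi i y + c) ->
  hamiltonian g phi i x p <= hamiltonian g phi' i x p + c.
Proof.
move=> phic' h; apply: ham_le => xi.
have := @ham_ge phi' i x p xi phic'; have := h (x, xi); lra.
Qed.

Lemma ham_add phi phi' i x p q : continuous_cost phi -> continuous_cost phi' ->
  hamiltonian g (phi + phi') i x (p + q) <=
  hamiltonian g phi i x p + hamiltonian g phi' i x q.
Proof.
move=> phic phic'; apply: ham_le => xi.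
have := @ham_ge phi i x p xi phic; have := @ham_ge phi' i x q xi phic'.
by rewrite dotpDr !fctE; lra.
Qed.

Lemma ham_scale phi t i x p : continuous_cost phi -> 0 <= t ->
  hamiltonian g (t *: phi) i x (t *: p) <= t * hamiltonian g phi i x p.
Proof.
move=> phic t0; apply: ham_le => xi.
rewrite dotpZr; change (- (t * dotp (g i (x, xi)) p) - t * phi i (x, xi) <=
  t * hamiltonian g phi i x p).
by rewrite -mulrN -mulrBr ler_wpM2l// ham_ge.
Qed.

Lemma ham_lipschitz : exists2 C, 0 <= C & forall phi i x p q, continuous_cost phi ->
  hamiltonian g phi i x p <= hamiltonian g phi i x q + C * `|p - q|.
Proof.
have [G G0 GP] := drift_bounded; exists (n%:R * G); first by rewrite mulr_ge0.
move=> phi i x p q phic; apply: ham_le => xi.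
have := @ham_ge phi i x q xi phic.
have : `|dotp (g i (x, xi)) (p - q)| <= n%:R * G * `|p - q|.
  by rewrite (le_trans (norm_dotp_le _ _))// ler_wpM2r// ler_wpM2l.
rewrite dotpDr -scaleN1r dotpZr mulN1r => /ler_normlP[h _].
by move: h; rewrite scaleN1r; lra.
Qed.

(** The increments of the drift and of the cost are controlled uniformly in the
    control variable, and the former is multiplied by [p], whence the bound [r]. *)
Lemma ham_near phi i (x0 : T) r e : continuous_cost phi -> 0 < e ->
  \forall x \near x0, forall p, `|p| <= r ->
    `|hamiltonian g phi i x p - hamiltonian g phi i x0 p| <= e.
Proof.
move=> phic e0; pose N := n%:R * `|r| + 1.
have N0 : 0 < N by rewrite ltr_wpDl// mulr_ge0.
have eN0 : 0 < e / N by rewrite divr_gt0.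
have := compact_fiber_continuous x0 Xi_compact (@g_cont i) eN0.
have := compact_fiber_continuous x0 Xi_compact (phic i) eN0.
apply: filterS2 => x hphi hg p pr.
have key xi : `|(- dotp (g i (x, xi)) p - phi i (x, xi)) -
                (- dotp (g i (x0, xi)) p - phi i (x0, xi))| <= e.
  rewrite (_ : _ - _ = - dotp (g i (x, xi) - g i (x0, xi)) p -
                (phi i (x, xi) - phi i (x0, xi))); last by rewrite dotpBl; ring.
  rewrite (le_trans (ler_normB _ _))// normrN.
  have -> : e = n%:R * (e / N) * `|r| + e / N by rewrite /N; field; rewrite gt_eqF.
  apply: lerD; last exact: hphi.
  rewrite (le_trans (norm_dotp_le _ _))// ler_pM// ?mulr_ge0//.
    by rewrite ler_wpM2l.
  exact: le_trans (ler_norm _).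
apply/ler_normlP; split.
  rewrite opprB lerBlDr; apply: ham_le => xi.
  have := @ham_ge phi i x p xi phic; have /ler_normlP[] := key xi; lra.
rewrite lerBlDr; apply: ham_le => xi.
have := @ham_ge phi i x0 p xi phic; have /ler_normlP[] := key xi; lra.
Qed.

(** Replacing [L] by [phi] moves the Hamiltonian by at most the sup norm of
    [phi - L].  The lower bound on the range is needed because an infimum over a
    set unbounded from below carries no information. *)
Lemma ham_coercive L phi : continuous_cost L -> continuous_cost phi ->
  coercive (hamiltonian g L) ->
  forall i K, exists2 r, 0 <= r & forall x p, r <= `|p| ->
    K <= hamiltonian g phi i x p.
Proof.
move=> Lc phic Hc i K; have [M M0 MP] := cost_bounded Lc.
have [M' M'0 MP'] := cost_bounded phic.
have [r rP] := Hc i (K + (M + M')).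
exists (Num.max r 0); first by rewrite le_max lexx orbT.
move=> x p; rewrite ge_max => /andP[rp _].
have /rP infK : r <= enorm p by rewrite (le_trans rp)// norm_le_enorm.
have [G G0 GP] := drift_bounded.
have lb : has_lbound (range (fun x => hamiltonian g L i x p)).
  exists (- (n%:R * G * `|p|) - M) => _ [y _ <-].
  apply: le_trans (@ham_ge L i y p point Lc).
  apply: lerB; last by rewrite (le_trans (ler_norm _)).
  rewrite lerN2 (le_trans (ler_norm _))//.
  by rewrite (le_trans (norm_dotp_le _ _))// ler_wpM2r// ler_wpM2l.
have : inf (range (fun x => hamiltonian g L i x p)) <= hamiltonian g L i x p.
  by apply: ge_inf => //; exists x.
have := @ham_mono L phi (M + M') i x p phic.
have h y : phi i y <= L i y + (M + M').
  by have /ler_normlP[] := MP i y; have /ler_normlP[] := MP' i y; lra.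
by move=> /(_ h); lra.
Qed.

End hamiltonian.

(** * Viscosity subsolutions and comparison *)

(** Coercivity as it is used: at each [x] instead of on an infimum over [x], and
    in the sup norm, which is the norm of row vectors here. *)
Definition uniformly_coercive (R : realType) (m n : nat)
    (F : 'I_m -> torus R n -> 'rV[R]_n -> R) :=
  forall i K, exists2 r, 0 <= r & forall x p, r <= `|p| -> K <= F i x p.

Section viscosity.
Context (R : realType) (m n : nat) (Xi : pmetricType R).
Context (g : 'I_m -> torus R n * Xi -> 'rV[R]_n).
Context (Xi_compact : compact [set: Xi]).
Context (g_cont : forall i, continuous (g i)).
Context (A : torus R n -> 'M[R]_m).
Context (A_cont : forall i j, continuous (fun x => A x i j)).
Local Notation T := (torus R n).
Local Notation H := (hamiltonian g).
Implicit Types (phi : 'I_m -> T * Xi -> R) (u v : 'I_m -> T -> R) (x : T).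

Lemma mxact_continuous u : (forall i, continuous (u i)) ->
  forall i, continuous (mxact A u i).
Proof.
move=> uc i.
have := @continuous_big R 'I_m +%R 0 xpredT (@add_continuous R) T (index_enum 'I_m)
  (fun j x => A x i j * u j x).
by apply => j _ x; exact: (cvgM (@A_cont i j x) (uc j x)).
Qed.

(** The touching inequality at [x] transferred to [x0].  Coercivity bounds the
    gradient by some [r] that does not depend on [e], so the dependence of the
    Hamiltonian on [x] is uniform over the gradients involved. *)
Lemma near_subsolution phi u : continuous_cost phi ->
  uniformly_coercive (H phi) ->
  subsolution A (H phi) u -> forall i (x0 : T), exists r, forall e, 0 < e ->
  \forall x \near x0, forall psi, C1 psi ->
    (forall w, u i w - psi w <= u i x - psi x) ->
    `|Dtorus psi x| <= r /\ mxact A u i x0 + H phi i x0 (Dtorus psi x) <= e.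
Proof.
move=> phic coer [uc usub] i x0.
have [r r0 rP] := coer i (2 - mxact A u i x0).
exists r => e e0.
have e20 : 0 < Num.min 1 (e / 2) by rewrite lt_min ltr01 divr_gt0.
have e2 : 0 < e / 2 by rewrite divr_gt0.
have mc : \forall x \near x0, `|mxact A u i x0 - mxact A u i x| < Num.min 1 (e / 2).
  by have /cvgrPdist_lt := @mxact_continuous u uc i x0; apply.
have := ham_near Xi_compact g_cont i x0 r phic e2.
apply: filterS2 mc => x mx hx psi psi1 psimax.
have sub := usub i psi x psi1 psimax.
move: mx; rewrite lt_min => /andP[/ltr_normlP[m1 m2] /ltr_normlP[m3 m4]].
have Dr : `|Dtorus psi x| <= r.
  rewrite leNgt; apply/negP => /ltW/(rP x); lra.
split => //.
by have /ler_normlP[] := hx _ Dr; lra.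
Qed.

(** Coercivity says nothing on gradients touching from below; the bound [r] has
    to be supplied by the caller. *)
Lemma near_supersolution phi v : continuous_cost phi ->
  supersolution A (H phi) v -> forall i (x0 : T) r e, 0 < e ->
  \forall x \near x0, forall psi, C1 psi ->
    (forall w, v i x - psi x <= v i w - psi w) ->
    `|Dtorus psi x| <= r -> - e <= mxact A v i x0 + H phi i x0 (Dtorus psi x).
Proof.
move=> phic [vc vsup] i x0 r e e0.
have e2 : 0 < e / 2 by rewrite divr_gt0.
have mc : \forall x \near x0, `|mxact A v i x0 - mxact A v i x| < e / 2.
  by have /cvgrPdist_lt := @mxact_continuous v vc i x0; apply.
have := ham_near Xi_compact g_cont i x0 r phic e2.
apply: filterS2 mc => x /ltr_normlP[m1 m2] hx psi psi1 psimin Dr.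
have sup := vsup i psi x psi1 psimin.
by have /ler_normlP[] := hx _ Dr; lra.
Qed.

Lemma C1_cst c : C1 (cst c : T -> R) /\ Dtorus (cst c : T -> R) = 0.
Proof.
have liftE : periodic_lift (cst c : T -> R) = cst c by [].
have gE : gradient (periodic_lift (cst c : T -> R)) = 0.
  by apply/funext => a; apply/rowP => j; rewrite !mxE liftE derive_cst.
split; last by apply/funext => x; rewrite /Dtorus gE.
split; first by move=> a; rewrite liftE; exact: differentiable_cst.
by rewrite gE; exact: cst_continuous.
Qed.

Lemma mxactD u v i x : mxact A (u + v) i x = mxact A u i x + mxact A v i x.
Proof. by rewrite /mxact -big_split; apply: eq_bigr => j _; rewrite /= mulrDr. Qed.

Lemma mxactZ c u i x : mxact A (c *: u) i x = c * mxact A u i x.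
Proof.
by rewrite /mxact big_distrr; apply: eq_bigr => j _; rewrite /= mulrCA.
Qed.

(** Joint convexity and homogeneity of [(phi, p) |-> H phi] give
    [H (phi + phi') (p + q) <= H phi p + H phi' q]; [fuzzy_sum_rule] supplies
    gradients [p] and [q] at nearby points whose sum is almost the gradient
    of the test function. *)
Lemma subsolutionD phi phi' u u' : continuous_cost phi -> continuous_cost phi' ->
  uniformly_coercive (H phi) ->
  uniformly_coercive (H phi') ->
  subsolution A (H phi) u -> subsolution A (H phi') u' ->
  subsolution A (H (phi + phi')) (u + u').
Proof.
move=> phic phic' coer coer' us us'; split.
  by move=> i x; exact: (cvgD (us.1 i x) (us'.1 i x)).
move=> i psi x0 psi1 psimax; rewrite mxactD.
have [r rP] := near_subsolution phic coer us i x0.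
have [r' r'P] := near_subsolution phic' coer' us' i x0.
have [C C0 CP] := ham_lipschitz Xi_compact g_cont.
apply/ler_addgt0Pl => e e0; rewrite addr0.
have e3 : 0 < e / 3 by rewrite divr_gt0.
have d0 : 0 < e / 3 / (C + 1) by rewrite divr_gt0// ltr_wpDl.
have [x [y [pa [pb [[[_ Nx] [Ny _] pa1 pb1] [pamax pbmax Dab]]]]]] :=
  fuzzy_sum_rule (us.1 i) (us'.1 i) psi1 psimax
    (filterI (r'P _ e3) (rP _ e3)) d0.
have [_ hx] := Nx pa pa1 pamax; have [_ hy] := Ny pb pb1 pbmax.
set p := Dtorus pa x in Dab hx *; set q := Dtorus pb y in Dab hy *.
have := ham_add Xi_compact g_cont i x0 p (Dtorus psi x0 - p) phic phic'.
rewrite (addrC p) subrK.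
have := CP phi' i x0 (Dtorus psi x0 - p) q phic'.
have : C * `|Dtorus psi x0 - p - q| <= e / 3.
  apply: (@le_trans _ _ (C * (e / 3 / (C + 1)))).
    by rewrite ler_wpM2l// -addrA -opprD distrC.
  by rewrite mulrCA ler_piMr ?(ltW e3)// ler_pdivrMr ?mul1r; lra.
by lra.
Qed.

(** At an index and a point maximizing [u - v], with a positive maximum, the
    coupling gives [A (u - v) > 0].  Applying [fuzzy_sum_rule] to [u_i] and
    [- v_i] with a constant test function gives almost the same gradient for
    both, hence [A (u - v) <= 0] in the limit. *)
Lemma comparison phi u v : continuous_cost phi -> uniformly_coercive (H phi) ->
  (forall x (w : 'cV[R]_m) i, (forall j, w j ord0 <= w i ord0) ->
    0 < w i ord0 -> 0 < (A x *m w) i ord0) ->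
  subsolution A (H phi) u -> supersolution A (H phi) v ->
  forall i x, u i x <= v i x.
Proof.
move=> phic coer Apos us vs i1 x1; rewrite leNgt; apply/negP => vu.
have uvc i : continuous (fun x => u i x - v i x).
  by move=> x; exact: (cvgB (us.1 i x) (vs.1 i x)).
have /choice[f fmax] : forall i, exists x, forall y, u i y - v i y <= u i x - v i x.
  move=> i; have [|||x _ xmax] := @compact_EVT_max T R (fun x => u i x - v i x) setT.
  - by exists point.
  - exact: torus_compact.
  - by apply: continuous_subspaceT; exact: uvc.
  by exists x => y; apply: xmax; rewrite in_setT.
have [i imax] : exists i, forall j, u j (f j) - v j (f j) <= u i (f i) - v i (f i).
  case: (@arg_maxP _ _ _ i1 xpredT (fun j => u j (f j) - v j (f j)) isT) => i _ imax.
  by exists i => j; exact: imax.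
pose x0 := f i.
have x0max j y : u j y - v j y <= u i x0 - v i x0.
  exact: le_trans (fmax j y) (imax j).
have x0pos : 0 < u i x0 - v i x0.
  by apply: lt_le_trans (x0max i1 x1); rewrite subr_gt0.
have Auv_gt0 : 0 < mxact A u i x0 - mxact A v i x0.
  have := Apos x0 (\col_j (u j x0 - v j x0)) i.
  rewrite !mxE => /(_ _ x0pos) h.
  have : forall j, (\col_j (u j x0 - v j x0)) j ord0 <= u i x0 - v i x0.
    by move=> j; rewrite mxE.
  move=> /h; congr (_ < _); rewrite /mxact -sumrB; apply: eq_bigr => j _.
  by rewrite mxE mulrBr.
set e := mxact A u i x0 - mxact A v i x0 in Auv_gt0.
have [r rP] := near_subsolution phic coer us i x0.
have e4 : 0 < e / 4 by rewrite divr_gt0.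
have vP := near_supersolution phic vs i x0 (r + 1) e4.
have [C C0 CP] := ham_lipschitz Xi_compact g_cont.
have d0 : 0 < Num.min 1 (e / 4 / (C + 1)).
  by rewrite lt_min ltr01/= divr_gt0// ltr_wpDl.
have [cst1 cst1D] := C1_cst 0.
have nvc : continuous (fun x => - v i x).
  by move=> x; exact: (cvgN (vs.1 i x)).
have [|x [y [pa [pb [[[_ Nx] [Ny _] pa1 pb1] [pamax pbmax Dab]]]]]] :=
  fuzzy_sum_rule (us.1 i) nvc cst1 _ (filterI vP (rP _ e4)) d0.
  by move=> y; rewrite /= !subr0.
have [pr hx] := Nx pa pa1 pamax.
have [npb1 npbD] := C1Z (-1) pb1.
have qE : Dtorus (-1 *: pb) y = - Dtorus pb y by rewrite npbD fctE /= scaleN1r.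
have vmin w : v i y - (-1 *: pb) y <= v i w - (-1 *: pb) w.
  change (v i y - -1 * pb y <= v i w - -1 * pb w).
  by have := pbmax w; lra.
move: Dab; rewrite cst1D subr0 le_min => /andP[Dab1 Dab2].
have qr : `|Dtorus (-1 *: pb) y| <= r + 1.
  rewrite qE normrN -[Dtorus pb y](addKr (Dtorus pa x)) addrC.
  by rewrite (le_trans (ler_normB _ _))// addrC lerD.
have := Ny (-1 *: pb) npb1 vmin qr; rewrite qE.
have := CP phi i x0 (- Dtorus pb y) (Dtorus pa x) phic.
have : C * `|- Dtorus pb y - Dtorus pa x| <= e / 4.
  apply: (@le_trans _ _ (C * (e / 4 / (C + 1)))).
    by rewrite ler_wpM2l// -opprD normrN addrC.
  by rewrite mulrCA ler_piMr ?(ltW e4)// ler_pdivrMr ?mul1r; lra.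
by move: Auv_gt0 hx; rewrite /e; lra.
Qed.

Lemma subsolution_mono phi phi' u : continuous_cost phi ->
  (forall i y, phi i y <= phi' i y) ->
  subsolution A (H phi) u -> subsolution A (H phi') u.
Proof.
move=> phic le_phi [uc usub]; split => // i psi x psi1 psimax.
have := usub i psi x psi1 psimax.
have h y : phi i y <= phi' i y + 0 by rewrite addr0.
have := ham_mono Xi_compact g_cont x (Dtorus psi x) phic h.
by rewrite addr0; lra.
Qed.

Lemma subsolutionZ phi u t : continuous_cost phi -> 0 < t ->
  subsolution A (H phi) u -> subsolution A (H (t *: phi)) (t *: u).
Proof.
move=> phic t0 [uc usub]; split.
  by move=> i x; exact: (cvgZl_tmp (k := t) (uc i x)).
move=> i psi x psi1 psimax; rewrite mxactZ.
have [tpsi1 tpsiD] := C1Z t^-1 psi1.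
have := usub i (t^-1 *: psi) x tpsi1; rewrite tpsiD.
have umax w : u i w - (t^-1 *: psi) w <= u i x - (t^-1 *: psi) x.
  change (u i w - t^-1 * psi w <= u i x - t^-1 * psi x).
  have := psimax w.
  change (t * u i w - psi w <= t * u i x - psi x ->
    u i w - t^-1 * psi w <= u i x - t^-1 * psi x).
  rewrite -(ler_pM2l t0 (u i w - _)) !mulrBr !mulrA mulfV ?gt_eqF// !mul1r.
  by [].
move=> /(_ umax).
have := ham_scale Xi_compact g_cont i x (t^-1 *: Dtorus psi x) phic (ltW t0).
rewrite scalerA mulfV ?gt_eqF// scale1r fctE /= => h1 h2.
have : t * (mxact A u i x + H phi i x (t^-1 *: Dtorus psi x)) <= 0.
  by rewrite pmulr_rle0.
by rewrite mulrDr; lra.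
Qed.

Lemma Dtorus_at_min (psi : T -> R) x : C1 psi -> (forall w, psi x <= psi w) ->
  Dtorus psi x = 0.
Proof.
move=> [dpsi _] xmin; apply/rowP => j; rewrite !mxE.
set f := periodic_lift psi; set v := delta_mx ord0 j; set a := repr x.
pose h (t : R) := f (t *: v + a).
have hd t : derivable h t 1.
  apply/derivable1_diffP.
  by apply: (@differentiable_comp _ _ _ _ (fun t : R => t *: v + a) f).
have : is_derive (0 : R) 1 h 0.
  apply: (@derive1_at_min _ h (-1) 1); [lra|by move=> t _|by rewrite in_itv/=; lra|].
  move=> t _; rewrite /h scale0r add0r /f /periodic_lift /a reprK.
  exact: xmin.
move=> [_ <-]; rewrite /derive; congr (lim _).
suff -> : (fun t : R => t^-1 *: ((f \o shift a) (t *: v) - f a)) =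
    (fun t : R => t^-1 *: ((h \o shift 0) (t *: (1 : R)) - h 0)) by [].
apply/funext => t; rewrite /= /h scale0r add0r addr0.
by rewrite (_ : t *: (1 : R) = t)//; exact: mulr1.
Qed.

(** A test function touching a constant from above has a vanishing gradient
    there, and at the momentum 0 the Hamiltonian is the maximum of minus the
    cost. *)
Lemma subsolution_cst c :
  subsolution A (H (fun i y => c * mxact A (@ones R m n) i y.1)) (fun=> cst c).
Proof.
split; first by move=> i; exact: cst_continuous.
move=> i psi x psi1 psimax; rewrite (Dtorus_at_min psi1); last first.
  by move=> w; have := psimax w; rewrite /cst; lra.
have -> : mxact A (fun=> cst c) i x = c * mxact A (@ones R m n) i x.
  rewrite -mxactZ /mxact; apply: eq_bigr => j _; congr (_ * _).
  exact/esym/mulr1.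
rewrite -lerBrDl sub0r; apply: ham_le => xi.
rewrite (_ : dotp _ 0 = 0) ?oppr0 ?sub0r//.
by rewrite /dotp big1// => j _; rewrite mxE mulr0.
Qed.

End viscosity.

(** * The representing measures *)

(** The sets [V n] consist of the points at distance more than [1 / (n + 1)] from
    the complement of [U], except that [d] need not be a distance: compactness
    of the complement replaces the triangle inequality. *)
Lemma open_exhaustion (R : realType) (X : topologicalType) (d : X * X -> R) :
  compact [set: X] -> continuous d -> (forall x, d (x, x) = 0) ->
  (forall x y, x <> y -> 0 < d (x, y)) ->
  forall U : set X, open U -> exists V : nat -> set X,
    [/\ forall n, open (V n), forall n, closure (V n) `<=` U
      & U `<=` \bigcup_n V n].
Proof.
move=> Xc dc dxx d_gt0 U oU.
have Kc : compact (~` U).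
  by apply: subclosed_compact Xc _ => //; exact: open_closedC.
exists (fun n => [set x | forall y, ~ U y -> n.+1%:R^-1 < d (x, y)]); split.
- move=> n; rewrite openE => x /= xV.
  have /(_ X (nbhs x) (fun x' y => n.+1%:R^-1 < d (x', y))) :=
    (compact_near_coveringP _).1 Kc.
  apply => y Uy.
  have [[P Q] /= [nP nQ] PQ] : \forall q \near (x, y), n.+1%:R^-1 < d q.
    by apply: (cvgr_gt _ (dc (x, y))); exact: xV.
  by exists (Q, P) => //= -[y' x'] /= [Qy' Px']; exact: (PQ (x', y')).
- move=> n x xV; apply: contrapT => Ux.
  have [[P Q] /= [nP nQ] PQ] : \forall q \near (x, x), d q < n.+1%:R^-1.
    by apply: (cvgr_lt _ (dc (x, x))); rewrite dxx invr_gt0.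
  have [x' [x'V Px']] := xV _ nP.
  have := x'V x Ux; rewrite ltNge => /negP; apply.
  by apply/ltW/(PQ (x', x)); split => //; exact: nbhs_singleton.
- move=> x Ux.
  have /(_ nat \oo (fun n y => n.+1%:R^-1 < d (x, y))) :=
    (compact_near_coveringP _).1 Kc.
  have h (y : X) : (~` U) y -> \forall y' \near y & n \near \oo, n.+1%:R^-1 < d (x, y').
    move=> Uy; have dxy : 0 < d (x, y) by apply: d_gt0 => xy; apply: Uy; rewrite -xy.
    have d2 : 0 < d (x, y) / 2 by rewrite divr_gt0.
    have [[P Q] /= [nP nQ] PQ] : \forall q \near (x, y), d (x, y) / 2 < d q.
      by apply: (cvgr_gt _ (dc (x, y))); lra.
    exists (Q, [set n : nat | n.+1%:R^-1 < d (x, y) / 2]) => /=.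
      split => //; exact: (near_infty_natSinv_lt (PosNum d2)).
    move=> [y' n] /= [Qy' ny']; apply: (lt_trans ny').
    by apply: (PQ (x, y')); split => //; exact: nbhs_singleton.
  move=> /(_ _ h)/filter_ex[n /= nV]; exists n => // y Uy; exact: nV.
Qed.

Lemma mdist_continuous (R : realType) (M : pmetricType R) :
  continuous (fun p : M * M => mdist p.1 p.2).
Proof.
move=> [a b]; apply/cvgrPdist_le => e e0.
have e2 : 0 < e / 2 by rewrite divr_gt0.
exists (ball a (e / 2), ball b (e / 2)); first by split; exact: nbhsx_ballx.
move=> [x y] [/=]; rewrite !ballEmdist /= => ax By.
have h1 := metric_triangle a x b; have h2 := metric_triangle x y b.
have h3 := metric_triangle x a y; have h4 := metric_triangle a b y.
have h5 := metric_sym a x; have h6 := metric_sym b y.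
by apply/ler_normlP; split; lra.
Qed.

Lemma torus_product_exhaustion (R : realType) (n : nat) (Xi : pmetricType R)
    (U : set (torus R n * Xi)) :
  compact [set: Xi] -> open U -> exists V : nat -> set (torus R n * Xi),
    [/\ forall i, open (V i), forall i, closure (V i) `<=` U
      & U `<=` \bigcup_i V i].
Proof.
move=> Xi_compact; set X := (torus R n * Xi)%type.
apply: (@open_exhaustion R X (fun q => sep q.1.1 q.2.1 + mdist q.1.2 q.2.2)).
- exact: cost_compact.
- move=> q.
  have h11 := @continuous_comp (X * X)%type X (torus R n) fst fst q cvg_fst cvg_fst.
  have h21 := @continuous_comp (X * X)%type X (torus R n) snd fst q cvg_snd cvg_fst.
  have h12 := @continuous_comp (X * X)%type X Xi fst snd q cvg_fst cvg_snd.
  have h22 := @continuous_comp (X * X)%type X Xi snd snd q cvg_snd cvg_snd.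
  apply: cvgD.
    apply: (@continuous2_cvg (X * X)%type (torus R n) (torus R n) R (nbhs q) _
      (fun r => r.1.1) (fun r => r.2.1) sep q.1.1 q.2.1); [|exact: h11|exact: h21].
    exact: (@sep_continuous R n (q.1.1, q.2.1)).
  apply: (@continuous2_cvg (X * X)%type Xi Xi R (nbhs q) _
    (fun r => r.1.2) (fun r => r.2.2) mdist q.1.2 q.2.2); [|exact: h12|exact: h22].
  exact: (@mdist_continuous R Xi (q.1.2, q.2.2)).
- by move=> x; rewrite sepxx mdistxx addr0.
- move=> [x xi] [y eta] /= neq; have [xy|/sep_gt0 sxy] := pselect (x = y).
    apply: ltr_wpDl; first exact: sep_ge0.
    by rewrite mdist_gt0; apply/eqP => e; apply: neq; rewrite xy e.
  by rewrite ltr_wpDr// mdist_ge0.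
Qed.

Theorem theorem6 (R : realType) (m n : nat) (Xi : pmetricType R)
    (g : 'I_m -> torus R n * Xi -> 'rV[R]_n)
    (L : 'I_m -> torus R n * Xi -> R)
    (B : torus R n -> 'M[R]_m)
    (lambda : R) (z : torus R n) (k : 'I_m)
    (v : 'I_m -> torus R n -> R)
    (n_gt0 : (0 < n)%N)
    (Xi_compact : compact [set: Xi])
    (g_cont : forall i, continuous (g i))
    (L_cont : forall i, continuous (L i))
    (B_cont : forall i j, continuous (fun x => B x i j))
    (H_coercive : coercive (hamiltonian g L))
    (B_monotone : forall x, monotone_matrix (B x))
    (lambda_gt0 : 0 < lambda)
    (v_sol : solution (shift_mx lambda B) (hamiltonian g L) v) :
  exists nu : 'I_m ->
      {finite_measure set (borel (torus R n * Xi)%type) -> \bar R},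
    Gdual g B z k lambda nu /\ v k z = pairing nu L.
Proof.
set A := shift_mx lambda B.
pose X := (torus R n * Xi)%type.
have Xc : compact [set: X] := cost_compact Xi_compact.
have A_cont i j : continuous (fun x => A x i j).
  move=> x; rewrite /A /shift_mx.
  under eq_fun do rewrite mxE.
  by rewrite mxE; exact: (cvgD (cvg_cst _) (B_cont i j x)).
have coer phi : continuous_cost phi -> uniformly_coercive (hamiltonian g phi).
  by move=> phic; exact: (ham_coercive Xi_compact g_cont L_cont).
have AE x (w : 'cV[R]_m) i : (A x *m w) i ord0 = lambda * w i ord0 + (B x *m w) i ord0.
  by rewrite /A /shift_mx mulmxDl mul_scalar_mx !mxE.
have A_pos x (w : 'cV[R]_m) i : (forall j, w j ord0 <= w i ord0) ->
    0 < w i ord0 -> 0 < (A x *m w) i ord0.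
  move=> wmax wi; rewrite AE ltr_pwDl ?mulr_gt0//.
  exact: B_monotone wmax (ltW wi).
have B1_ge i x : lambda <= mxact A (@ones R m n) i x.
  have -> : mxact A (@ones R m n) i x = (A x *m (const_mx 1 : 'cV[R]_m)) i ord0.
    by rewrite mxE; apply: eq_bigr => j _; congr (_ * _); rewrite mxE.
  rewrite AE mxE mulr1 lerDl; apply: B_monotone => [j|]; by rewrite !mxE.
(* The cost for which the constant [c] is a subsolution. *)
pose b1 c : 'I_m -> X -> R := fun i y => c * mxact A (@ones R m n) i y.1.
have b1c c : continuous_cost (b1 c).
  move=> i y; apply: (cvgM (cvg_cst c)).
  apply: (@continuous_comp X (torus R n) R fst (mxact A (@ones R m n) i) y).
    exact: cvg_fst.
  by apply: mxact_continuous => // j; exact: (@cst_continuous _ _ (1 : R)).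
have F_cst c : Fset g B lambda (b1 c, fun=> cst c).
  by split; [exact: b1c|exact: subsolution_cst].
have F_L : Fset g B lambda (L, v) by split; [exact: L_cont|exact: v_sol.1].
have FD phi u phi' u' : Fset g B lambda (phi, u) -> Fset g B lambda (phi', u') ->
    Fset g B lambda (phi + phi', u + u').
  move=> [phic us] [phic' us']; split.
    by move=> i y; exact: (cvgD (phic i y) (phic' i y)).
  by apply: (subsolutionD Xi_compact g_cont A_cont) => //; exact: coer.
have FZ phi u t : 0 < t -> Fset g B lambda (phi, u) ->
    Fset g B lambda (t *: phi, t *: u).
  move=> t0 [phic us]; split.
    by move=> i y; exact: (cvgZl_tmp (k := t) (phic i y)).
  exact: (subsolutionZ Xi_compact g_cont).
have Fle phi u t i x : 0 <= t -> Fset g B lambda (phi, u) ->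
    (forall j y, phi j y <= t * L j y) -> u i x <= t * v i x.
  (* Adding [(L, v)] first makes the factor [t + 1] positive, so that [t = 0]
     needs no separate argument. *)
  move=> t0 Fu le_phi; have t1 : 0 < t + 1 by rewrite ltr_wpDl.
  have [phic us] := FZ _ _ (t + 1)^-1 (etrans (invr_gt0 _) t1) (FD _ _ _ _ Fu F_L).
  have le_L j y : ((t + 1)^-1 *: (phi + L)) j y <= L j y.
    change ((t + 1)^-1 * (phi j y + L j y) <= L j y).
    by rewrite ler_pdivrMl// mulrDl mul1r lerD2r.
  have us' := subsolution_mono Xi_compact g_cont phic le_L us.
  have := comparison Xi_compact g_cont A_cont L_cont (coer _ L_cont) A_pos us' v_sol.2 i x.
  change ((t + 1)^-1 * (u i x + v i x) <= v i x -> u i x <= t * v i x).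
  by rewrite ler_pdivrMl// mulrDl mul1r lerD2r.
pose Y := ('I_m * X)%type.
pose emb (phi : 'I_m -> X -> R) : Y -> R := fun p => phi p.1 p.2.
have emb_bounded phi : continuous_cost phi -> bounded_real (emb phi).
  by move=> /(cost_bounded Xi_compact)[M _ MP]; exists M => p; exact: MP.
(* Costs of all components are functions of one variable in [Y], so that a
   single functional is enough; [part] below splits it again. *)
pose C : set ((Y -> R) * R) := [set hc | exists phi u t,
  [/\ Fset g B lambda (phi, u), 0 <= t &
      hc = (emb phi - t *: emb L, u k z - t * v k z)]].
have C_F phi u : Fset g B lambda (phi, u) -> C (emb phi, u k z).
  by move=> Fu; exists phi, u, 0; split => //; rewrite scale0r mul0r !subr0.
have C_L : C (- emb L, - v k z).
  exists (b1 0), (fun=> cst 0), 1; split => //; rewrite scale1r mul1r; congr (_, _).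
    by apply/funext => p; rewrite !fctE /= /emb /b1 mul0r sub0r.
  by rewrite /cst sub0r.
have [||||ell [ellD ellZ ell_ge0 ellC]] := @positive_functional_of_cone R Y C.
- move=> h c h' c' [phi [u [t [Fu t0 [-> ->]]]]] [phi' [u' [t' [Fu' t'0 [-> ->]]]]].
  exists (phi + phi'), (u + u'), (t + t').
  split; [exact: (FD _ _ _ _ Fu Fu')|exact: addr_ge0|].
  congr (_, _); last by rewrite !fctE; ring.
  by rewrite scalerDl opprD addrACA.
- move=> s h c; rewrite le_eqVlt => /predU1P[<- _|s0 [phi [u [t [Fu t0 [-> ->]]]]]].
    rewrite scale0r mul0r; have := C_F _ _ (F_cst 0); congr (C (_, _)).
    by apply/funext => p; rewrite /emb /b1 mul0r.
  exists (s *: phi), (s *: u), (s * t).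
  split; [exact: (FZ _ _ s s0 Fu)|by rewrite mulr_ge0// ltW|].
  congr (_, _); last by rewrite mulrBr mulrA.
  by rewrite scalerBr scalerA.
- exists (emb (b1 (- lambda^-1))), (- lambda^-1); split; first exact: (C_F _ _ (F_cst _)).
  move=> p; rewrite /emb /b1 mulNr lerN2 ler_pdivlMl// mulr1; exact: B1_ge.
- move=> h c [phi [u [t [Fu t0 [-> ->]]]]] hle; rewrite subr_le0.
  apply: (Fle phi u t k z t0 Fu) => j y.
  by have := hle (j, y); rewrite !fctE subr_le0.
pose part i (f : X -> R) : Y -> R := fun p => if p.1 == i then f p.2 else 0.
have part_bounded i f : bounded_real f -> bounded_real (part i f).
  move=> [M MP]; exists M => p; rewrite /part; case: ifP => // _.
  by rewrite normr0 (le_trans _ (MP p.2)).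
have /choice[nu nuP] : forall i, exists nu : {finite_measure set (borel X) -> \bar R},
    forall f : X -> R, continuous f -> ell (part i f) = Rintegral nu setT f.
  move=> i; apply: (riesz_representation Xc).
  - by move=> U; exact: torus_product_exhaustion.
  - move=> f f' bf bf'; rewrite -ellD; [|exact: part_bounded..].
    congr ell; apply/funext => p.
    change (part i (f + f') p = part i f p + part i f' p).
    by rewrite /part; case: ifP => // _; rewrite addr0.
  - move=> t f bf; rewrite -ellZ; last exact: part_bounded.
    congr ell; apply/funext => p.
    change (part i (t *: f) p = t * part i f p).
    by rewrite /part; case: ifP => // _; rewrite mulr0.
  - move=> f bf f0; apply: ell_ge0; first exact: part_bounded.
    by move=> p; rewrite /part; case: ifP.
have ell_sum (F : 'I_m -> Y -> R) (r : seq 'I_m) : (forall i, bounded_real (F i)) ->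
    bounded_real (\sum_(i <- r) F i) /\ ell (\sum_(i <- r) F i) = \sum_(i <- r) ell (F i).
  move=> bF; elim: r => [|i r [b IH]].
    have b0 : bounded_real (0 : Y -> R) by exists 0 => p; rewrite -[leRHS](normr0 R).
    by rewrite !big_nil; split => //; rewrite -(scale0r 0) ellZ// mul0r.
  rewrite !big_cons; split; last by rewrite ellD// IH.
  have [[M MP] [N NP]] := (bF i, b); exists (M + N) => p.
  by rewrite fctE (le_trans (ler_normD _ _))// lerD.
have nuE phi : continuous_cost phi -> pairing nu phi = ell (emb phi).
  move=> phic; have bp i : bounded_real (part i (phi i)).
    by apply: part_bounded; exact: (compact_continuous_bounded Xc (phic i)).
  have -> : emb phi = \sum_i part i (phi i).
    apply/funext => p; rewrite fct_sumE (bigD1 p.1)//= /part eqxx big1 ?addr0//.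
    by move=> i /negbTE; rewrite eq_sym => ->.
  rewrite (ell_sum _ _ bp).2 /pairing; apply: eq_bigr => i _.
  by rewrite nuP//; exact: phic.
have ell_F phi u : Fset g B lambda (phi, u) -> u k z <= ell (emb phi).
  by move=> Fu; apply: ellC; [exact: emb_bounded Fu.1|exact: C_F].
have ellN f : bounded_real f -> ell (- f) = - ell f.
  by move=> bf; rewrite -scaleN1r ellZ// mulN1r.
have bN (f : Y -> R) : bounded_real f -> bounded_real (- f).
  by move=> [M MP]; exists M => p; rewrite fctE normrN.
have bonesE : Bones B lambda = b1 1.
  by apply/funext => i; apply/funext => y; rewrite /b1 mul1r.
have ell1 : ell (emb (b1 1)) = 1.
  apply/eqP; rewrite eq_le (ell_F _ _ (F_cst 1)) andbT -lerN2 -ellN;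
    last exact: emb_bounded.
  have := ell_F _ _ (F_cst (-1)); congr (_ <= ell _); apply/funext => p.
  by rewrite fctE /emb /b1 mulN1r mul1r.
exists nu; split; last first.
  apply/eqP; rewrite eq_le nuE// (ell_F _ _ F_L) -lerN2 -ellN; last exact: emb_bounded.
  by apply: ellC => //; apply: bN; exact: emb_bounded.
split; first by rewrite /Pset /= bonesE nuE.
move=> _ [[phi u] Fu <-] /=.
rewrite bonesE (_ : (fun _ => _) = phi + (- u k z) *: b1 1); last first.
  apply/funext => i; apply/funext => y.
  change (phi i y - u k z * b1 1 i y = phi i y + - u k z * b1 1 i y).
  by rewrite mulNr.
have cu : continuous_cost (phi + (- u k z) *: b1 1).
  move=> i y; exact: (cvgD (Fu.1 i y) (cvgZl_tmp (k := - u k z) (b1c 1 i y))).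
rewrite nuE// (_ : emb _ = emb phi + (- u k z) *: emb (b1 1))//.
have b11 := emb_bounded _ (b1c 1).
have bphi := emb_bounded phi Fu.1.
have bu : bounded_real ((- u k z) *: emb (b1 1)).
  have [M MP] := b11; exists (`|u k z| * M) => p.
  change (`|- u k z * emb (b1 1) p| <= `|u k z| * M).
  by rewrite normrM normrN ler_wpM2l.
by rewrite ellD// ellZ// ell1 mulr1 subr_ge0; exact: ell_F.
Qed.
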